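(* Let $a,c\in\mathbb{Z}$, $k,m,n\in\mathbb{N}$ with $km>n\ge1$, and suppose $f(x)=(x^k+c)^m-ax^n$ is irreducible over $\mathbb{Q}$. Let $\theta$ be a root of $f$, $K=\mathbb{Q}(\theta)$, $t=\gcd(n,k)$, $n=n_1t$, $k=k_1t$. Let $p$ be a prime dividing $\mathfrak{D}_f$. Then $p\nmid[\mathbb{Z}_K:\mathbb{Z}[\theta]]$ if and only if the condition below corresponding to the case into which $p$ falls holds: (i) If $p\mid c$ and $p\mid a$: $m=1$ and $p^2\nmid c$. (ii) If $p\mid c$, $p\nmid a$ and $n=1$: letting $j=v_p(km-1)$ (which is $\ge1$), $c_2=c/p$ and $a_1=(a^{p^j}-a)/p$, either ($p\mid c_2$ and $p\nmid a_1$) or $p\nmid c_2\,[a^k a_1^{km-1}-(-mac_2)^{km-1}]$. (iii) If $p\mid c$, $p\nmid a$ and $n\ge2$: $m=1$, and, with $\ell=v_p(k-n)\ge0$, $c_2=c/p$ and $a_1=(a^{p^\ell}-a)/p$, either ($p\mid a_1$ and $p\nmid c_2$) or $p\nmid a_1c_2^{\,n-1}[a^{n_1}a_1^{k_1-n_1}-(-c_2)^{k_1-n_1}]$. (iv) If $p\nmid c$ and $p\mid a$: (a) if $m\ge2$, then $p^2\nmid a$; (b) if $m=1$, then, with $\ell=v_p(k)$ (which is $\ge1$), $a_2=-a/p$ and $c_1=((-c)^{p^\ell}+c)/p$, either ($p\mid a_2$ and $p\nmid c_1$) or $p\nmid a_2[a_2^{k_1}(-c)^{n_1}-(-c_1)^{k_1}]$.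 (v) If $p\nmid ca$ and $p\mid k$: write $k=p^js'$, $n=p^js$ with $j\ge1$ and $p\nmid\gcd(s,s')$; let $a_1=(a^{p^j}-a)/p$ and $t(x)=\frac1p\left(\sum_{i=0}^{p^j-1}\binom{p^j}{i}x^{s'i}c^{p^j-i}-c\right)\in\mathbb{Z}[x]$. Then the reductions modulo $p$ of the polynomials $\frac1p\left[pa_1x^n-pm\,t(x)(x^k+c)^{m-1}\right]=a_1x^n-m\,t(x)(x^k+c)^{m-1}$ and $(x^{s'}+c)^m-ax^s$ are coprime in $\mathbb{F}_p[x]$. (vi) If $p\nmid cak$ and $p\mid m$: $p\mid n$ and $p^2\nmid(a^p-a)$. (vii) If $p\nmid cakm$: $p^2\nmid(\mathcal{C}-\mathcal{E})$. Consequently, $\mathbb{Z}_K=\mathbb{Z}[\theta]$ if and only if every prime dividing $\mathfrak{D}_f$ satisfies its corresponding condition.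
   Context: $\mathfrak{D}_f$ is the discriminant of $f$; $\mathbb{Z}_K$ is the ring of integers of $K$; $v_p$ is the $p$-adic valuation. $\mathcal{C}=(km)^{k_1m}c^{k_1m-n_1}$ and $\mathcal{E}=a^{k_1}n^{n_1}(km-n)^{k_1m-n_1}$. *)

(* Defs.v *)
From HB Require Import structures.
From mathcomp Require Import all_boot all_order all_algebra all_field.
Set Implicit Arguments. Unset Strict Implicit. Unset Printing Implicit Defensive.
Import Order.TTheory GRing.Theory Num.Theory.
Local Open Scope ring_scope.

Definition fpoly (a c : int) (k m n : nat) : {poly int} :=
  ('X^k + c%:P) ^+ m - a%:P * 'X^n.

(* Discriminant of a MONIC polynomial p of degree d:
   (-1)^(d(d-1)/2) Res(p, p'). (For monic p the usual division by the
   leading coefficient is trivial.) *)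
Definition disc_monic (R : comNzRingType) (p : {poly R}) : R :=
  let d := (size p).-1 in (-1) ^+ (d * d.-1 %/ 2) * resultant p p^`().

Definition Ztheta (theta : algC) (x : algC) : Prop :=
  exists q : {poly int}, x = (map_poly intr q).[theta].

Definition Qtheta (theta : algC) (x : algC) : Prop :=
  exists q : {poly rat}, x = (map_poly ratr q).[theta].

Definition ZK (theta : algC) (x : algC) : Prop :=
  Qtheta theta x /\ x \in Aint.

(* [Z_K : Z[theta]] = d : the quotient group Z_K / Z[theta] has exactly d
   elements, i.e. there are d representatives in Z_K, pairwise incongruent
   modulo Z[theta], covering every class. *)
Definition ZK_index_is (theta : algC) (d : nat) : Prop :=
  exists s : seq algC,
    [/\ size s = d,
        (forall x, x \in s -> ZK theta x),
        (forall i j, (i < d)%N -> (j < d)%N -> i <> j ->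
            ~ Ztheta theta (s`_i - s`_j)) &
        (forall x, ZK theta x -> exists2 i, (i < d)%N & Ztheta theta (x - s`_i))].

Definition p_not_dvd_index (theta : algC) (p : nat) : Prop :=
  exists d, ZK_index_is theta d /\ ~~ (p %| d)%N.

Local Open Scope int_scope.
Local Notation "x %/ d" := (divz x d) : int_scope.

Definition tpoly (p j s' : nat) (c : int) : {poly int} :=
  map_poly (fun z : int => divz z (p%:Z))
    ((\sum_(i < p ^ j) ((('C(p ^ j, i))%:R * c ^+ (p ^ j - i))%R)%:P * 'X^(s' * i))
       - c%:P)%R.

Definition redp (p : nat) (q : {poly int}) : {poly 'F_p} :=
  map_poly (fun z : int => (z%:~R : 'F_p)) q.

(* The condition attached to p, by cases (i)-(vii). Cases are exhaustive and
   mutually exclusive, so we encode "the condition of the case p falls in" as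
   the conjunction of the implications "case -> condition". *)
Definition cond (a c : int) (k m n p : nat) : Prop :=
  let P := p%:Z in
  let t := gcdn n k in let n1 := (n %/ t)%N in let k1 := (k %/ t)%N in
  ((P %| c)%Z -> (P %| a)%Z -> m = 1%N /\ ~~ (P ^+ 2 %| c)%Z) /\
  ((P %| c)%Z -> ~~ (P %| a)%Z -> n = 1%N ->
     let j := logn p (k * m - 1) in
     let c2 := divz c P in
     let a1 := divz (a ^+ (p ^ j) - a) P in
     ((P %| c2)%Z && ~~ (P %| a1)%Z) \/
     ~~ (P %| c2 * (a ^+ k * a1 ^+ (k * m - 1) - (- (m%:Z * a * c2)) ^+ (k * m - 1)))%Z) /\
  ((P %| c)%Z -> ~~ (P %| a)%Z -> (2 <= n)%N ->
     m = 1%N /\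
     (let l := logn p (k - n) in
      let c2 := divz c P in
      let a1 := divz (a ^+ (p ^ l) - a) P in
      ((P %| a1)%Z && ~~ (P %| c2)%Z) \/
      ~~ (P %| a1 * c2 ^+ (n - 1) *
              (a ^+ n1 * a1 ^+ (k1 - n1) - (- c2) ^+ (k1 - n1)))%Z)) /\
  (~~ (P %| c)%Z -> (P %| a)%Z ->
     ((2 <= m)%N -> ~~ (P ^+ 2 %| a)%Z) /\
     (m = 1%N ->
        let l := logn p k in
        let a2 := divz (- a) P in
        let c1 := divz ((- c) ^+ (p ^ l) + c) P in
        ((P %| a2)%Z && ~~ (P %| c1)%Z) \/
        ~~ (P %| a2 * (a2 ^+ k1 * (- c) ^+ n1 - (- c1) ^+ k1))%Z)) /\
  (~~ (P %| c)%Z -> ~~ (P %| a)%Z -> (p %| k)%N ->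
     let j := minn (logn p k) (logn p n) in
     let s' := (k %/ p ^ j)%N in
     let s := (n %/ p ^ j)%N in
     let a1 := divz (a ^+ (p ^ j) - a) P in
     let tt := tpoly p j s' c in
     coprimep
       (redp p (a1%:P * 'X^n - (m%:Z)%:P * tt * ('X^k + c%:P) ^+ (m - 1))%R)
       (redp p (('X^s' + c%:P) ^+ m - a%:P * 'X^s)%R)) /\
  (~~ (P %| c)%Z -> ~~ (P %| a)%Z -> ~~ (p %| k)%N -> (p %| m)%N ->
     (p %| n)%N /\ ~~ (P ^+ 2 %| a ^+ p - a)%Z) /\
  (~~ (P %| c)%Z -> ~~ (P %| a)%Z -> ~~ (p %| k)%N -> ~~ (p %| m)%N ->
     let CC := ((k * m)%:Z) ^+ (k1 * m) * c ^+ (k1 * m - n1) in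
     let EE := a ^+ k1 * (n%:Z) ^+ n1 * ((k * m - n)%:Z) ^+ (k1 * m - n1) in
     ~~ (P ^+ 2 %| CC - EE)%Z).

(* Main.v *)
(** Index. The quotient Z_K / Z[theta] is finite: if D = U f + V f', Lagrange
    interpolation at the conjugates of theta gives D Z_K in Z[theta]. Hence
    p does not divide the index iff Z_K / Z[theta] has no p-torsion.

    Dedekind. There is p-torsion iff f lies in the square of a maximal ideal
    (p, g) of Z[X]. If f = g^2 A + p g B + p^2 C, then y = (g A + p B)(theta) / p
    satisfies y^2 - B y + C A = 0, so y is integral, and y is not in Z[theta].
    Conversely, from an integral q(theta) / p outside Z[theta] one gets
    f = g h + p M with h(theta) / p integral; homogenising an integral equation of
    h(theta) / p = - M(theta) / g(theta) shows that g divides h and M modulo p.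

    Cases. Let b be a root of g in an algebraic closure K of F_p. If
    S f = h^2 A + p h B + p M with h(b) = 0 and S(b) <> 0, then f is in (p, g)^2
    iff M(b) = 0. Each case of the theorem is a choice of h (for instance
    X^s - a when km - n = p^j s), the p-power h-expansion being
    (h + z)^(p^j) = z^(p^j) modulo (p h, h^2). When p divides neither c, a, k
    nor m, with D = km - n, h = D X^k - n c and n = n1 t, k = k1 t, one expands
    (D^m (X^k + c)^m)^k1 - (a D^m X^n)^k1, a multiple of f whose constant term
    in h is c^n1 (C - E). *)
Require Import Defs.
From HB Require Import structures.
From mathcomp Require Import all_boot all_order all_algebra all_fingroup all_solvable all_field.
From mathcomp Require Import ring zify.
Set Implicit Arguments. Unset Strict Implicit. Unset Printing Implicit Defensive.
Import Order.TTheory GRing.Theory Num.Theory.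
Local Open Scope ring_scope.

(** * Maximal ideals of Z[X] above p *)

Section Evaluation.
Variable R : comNzRingType.
Implicit Types (b : R) (q r : {poly int}).

(** Evaluation is kept generic because it takes place both in [algC], at [theta], and in an
    algebraic closure of ['F_p], at a residual root [b]. *)
Definition ev b q : R := (map_poly intr q).[b].

Lemma evD b q r : ev b (q + r) = ev b q + ev b r.
Proof. by rewrite /ev rmorphD hornerD. Qed.
Lemma evN b q : ev b (- q) = - ev b q.
Proof. by rewrite /ev rmorphN hornerN. Qed.
Lemma evM b q r : ev b (q * r) = ev b q * ev b r.
Proof. by rewrite /ev rmorphM hornerM. Qed.
Lemma evXn b q i : ev b (q ^+ i) = ev b q ^+ i.
Proof. by rewrite /ev rmorphXn horner_exp. Qed.
Lemma evC b z : ev b z%:P = z%:~R.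
Proof. by rewrite /ev map_polyC hornerC. Qed.
Lemma ev1 b : ev b 1 = 1.
Proof. by rewrite evC. Qed.
Lemma ev0 b : ev b 0 = 0.
Proof. by rewrite evC. Qed.
Lemma evX b : ev b 'X = b.
Proof. by rewrite /ev map_polyX hornerX. Qed.
Lemma evMn b q i : ev b (q *+ i) = ev b q *+ i.
Proof. by elim: i => [|i IH]; rewrite ?mulr0n ?ev0 // !mulrS evD IH. Qed.
Definition evE := (evD, evN, evM, evXn, evC, ev1, ev0, evX, evMn).

End Evaluation.

Section ModP.
Variables (p : nat) (K : closedFieldType) (FtoK : {rmorphism 'F_p -> K}).
Hypotheses (p_pr : prime p) (FtoK_alg : integralRange FtoK).

Local Notation P := ((p%:Z)%:P : {poly int}).

Lemma pcharK : p \in [pchar K].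
Proof. by rewrite (fmorph_pchar FtoK) pchar_Fp. Qed.

Lemma intr_eq0_dvdz (R : nzRingType) (z : int) :
  p \in [pchar R] -> (z%:~R == 0 :> R) = (p %| z)%Z.
Proof.
move=> pR; case: z => n.
  by rewrite -pmulrn -(dvdn_pcharf pR).
by rewrite NegzE mulrNz oppr_eq0 -pmulrn -(dvdn_pcharf pR) dvdzE abszN.
Qed.

Lemma intrK_eq0 (z : int) : (z%:~R == 0 :> K) = (p %| z)%Z.
Proof. exact: intr_eq0_dvdz pcharK. Qed.

Lemma intP0 : (p%:Z)%:~R = 0 :> K.
Proof. by apply/eqP; rewrite intrK_eq0. Qed.

Lemma evP0 (b : K) : ev b P = 0.
Proof. by rewrite evC intP0. Qed.

Lemma map_redp q : map_poly FtoK (redp p q) = map_poly intr q.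
Proof.
by rewrite -map_poly_comp; apply: eq_map_poly => z /=; rewrite rmorph_int.
Qed.

Lemma redpE q : redp p q = map_poly intr q. Proof. by []. Qed.

Lemma redpP : redp p P = 0.
Proof.
rewrite redpE map_polyC /=; apply/eqP; rewrite polyC_eq0.
by rewrite intr_eq0_dvdz ?pchar_Fp.
Qed.

Lemma redp_eq0 q : redp p q = 0 -> exists q', q = P * q'.
Proof.
move=> q0; exists (map_poly (fun z => z %/ p)%Z q); apply/polyP=> i.
rewrite coefCM coef_map_id0 ?div0z // mulrC divzK //.
have /polyP/(_ i)/eqP := q0; rewrite redpE coef_map coef0 /=.
by rewrite intr_eq0_dvdz ?pchar_Fp.
Qed.

Lemma redp_lift (q : {poly 'F_p}) : exists Q, redp p Q = q.
Proof.
exists (map_poly (fun x : 'F_p => (x : nat)%:Z) q); apply/polyP=> i.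
rewrite redpE coef_map coef_map_id0 //=.
by rewrite -pmulrn natr_Zp.
Qed.

Lemma P_neq0 : P != 0.
Proof. by rewrite polyC_eq0; case: p p_pr. Qed.

(* [kernel_gen b g]: [g] reduces to the minimal polynomial of [b], and [(p, g)]
   is the ideal of the integer polynomials vanishing at [b]. *)
Definition kernel_gen (b : K) (g : {poly int}) :=
  irreducible_poly (redp p g) /\
  forall q, ev b q = 0 <-> exists w z, q = g * w + P * z.

(** The minimal polynomial of [b] over ['F_p] exists because [K] is algebraic over ['F_p]; any
    integer lift of it serves as [g]. *)
Lemma kernel_gen_exists b : exists g, kernel_gen b g.
Proof.
have decF : decidable_embedding FtoK.
  move=> y; case: (boolP [exists x, y == FtoK x]) => [/existsP h|/existsP h].
    by left; case: h => x /eqP; exists x.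
  by right=> -[x e]; apply: h; exists x; apply/eqP.
have [g' [_ rg' irr]] := minPoly_decidable_closure decF (FtoK_alg b).
have [g gg'] := redp_lift g'; exists g; split; first by rewrite gg'.
have evg : ev b g = 0 by rewrite /ev -map_redp gg'; apply/eqP.
(* An irreducible polynomial not dividing [redp p q] is coprime to it, which the common root [b]
   excludes. *)
move=> q; split=> [q0|[w [z ->]]]; last by rewrite !evE evg intP0; ring.
have : g' %| redp p q.
  apply: contraT; rewrite -irreducible_poly_coprime // -(coprimep_map FtoK).
  move/coprimep_root=> /(_ _ rg'); rewrite map_redp -[(map_poly _ _).[_]]/(ev b q).
  by rewrite q0 eqxx.
case/dvdpP=> w'; have [w <-] := redp_lift w' => e.
have [|z ez] := @redp_eq0 (q - w * g); first by rewrite redpE rmorphB rmorphM /= -!redpE gg' e subrr.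
by exists w, z; rewrite -ez; ring.
Qed.

Lemma ev_kernel_gen b g : kernel_gen b g -> ev b g = 0.
Proof. by case=> _ /(_ g) ->; exists 1, 0; ring. Qed.

(* Membership in [(p, g)^2]. *)
Definition insq (g q : {poly int}) :=
  exists A B C, q = g * g * A + P * g * B + P * P * C.

Lemma insqD g q r : insq g q -> insq g r -> insq g (q + r).
Proof.
move=> [A [B [C ->]]] [A' [B' [C' ->]]]; exists (A + A'), (B + B'), (C + C').
by ring.
Qed.
Lemma insqM g q r : insq g q -> insq g (r * q).
Proof. move=> [A [B [C ->]]]; exists (r * A), (r * B), (r * C); ring. Qed.
Lemma insqN g q : insq g q -> insq g (- q).
Proof. by rewrite -mulN1r; apply: insqM. Qed.
Lemma insq_gen b g q r : kernel_gen b g -> ev b q = 0 -> ev b r = 0 -> insq g (q * r).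
Proof.
move=> [_ G] /G[w [z ->]] /G[w' [z' ->]].
by exists (w * w'), (w * z' + w' * z), (z * z'); ring.
Qed.

(** Modulo [p] the equation reads g^2 A = 0 in a domain, so [p] divides [A]; cancelling one [p]
    leaves [M] in the ideal (p, g). *)
Lemma insq_cancel b g M : kernel_gen b g -> insq g (P * M) -> ev b M = 0.
Proof.
move=> Gg [A [B [C e]]]; have [irr _] := Gg.
have [A' eA] : exists A', A = P * A'.
  apply: redp_eq0; apply/eqP; have /(congr1 (redp p)) := e.
  rewrite !redpE !(rmorphD, rmorphM) /= -!redpE redpP !mul0r !addr0.
  move/esym/eqP; rewrite !mulf_eq0.
  have /negPf-> : redp p g != 0 by apply: irredp_neq0.
  by [].
have -> : M = g * g * A' + g * B + P * C.
  by apply: (mulfI P_neq0); rewrite e eA; ring.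
by rewrite !evE intP0 (ev_kernel_gen Gg); ring.
Qed.

(** The point [b] of [K] stands for the maximal ideal (p, g) of its kernel, so that Dedekind's
    criterion becomes a set of equations in [b]. *)
Definition bad (f : {poly int}) (b : K) := exists g, kernel_gen b g /\ insq g f.

(** Both [h] and [p] lie in (p, g), so only the term [P * M] can keep [S * f] out of the square. The
    factor [S], invertible modulo (p, g), allows [f] to be replaced by a multiple that expands
    better. *)
Lemma bad_iff f S h A B M b :
  S * f = h * h * A + P * h * B + P * M ->
  ev b h = 0 -> ev b S != 0 -> bad f b <-> ev b M = 0.
Proof.
move=> e h0 S0; split=> [[g [Gg f2]]|M0].
  apply: (insq_cancel Gg).
  have -> : P * M = S * f + - (A * (h * h)) + - (B * (P * h)) by rewrite e; ring.
  apply: insqD; first apply: insqD.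
  - exact: insqM.
  - by apply/insqN/insqM; apply: insq_gen Gg _ _.
  - by apply/insqN/insqM; apply: insq_gen Gg _ _; rewrite ?evP0.
have [g Gg] := kernel_gen_exists b; exists g; split=> //.
have f0 : ev b f = 0.
  by apply: (mulfI S0); rewrite -evM e !evE intP0 h0 M0; ring.
have [irr G] := Gg.
have : coprimep (redp p g) (redp p S).
  rewrite irreducible_poly_coprime //; apply: contra S0 => /dvdpP[w'].
  have [w <-] := redp_lift w'; rewrite /ev -map_redp => ->.
  by rewrite rmorphM hornerM /= !map_redp -!/(ev _ _) (ev_kernel_gen Gg) mulr0.
case/Bezout_eq1_coprimepP=> [[v' u'] /=].
have [v <-] := redp_lift v'; have [u <-] := redp_lift u' => e1.
have u1 : ev b (1 - u * S) = 0.
  have /(congr1 (fun q => (map_poly FtoK q).[b])) := e1.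
  rewrite rmorphD !rmorphM rmorph1 !hornerE /= !map_redp -!/(ev _ _) (ev_kernel_gen Gg).
  by rewrite mulr0 add0r !evE => ->; rewrite subrr.
(* An inverse [u] of [S] modulo (p, g) itself is enough: [1 - u * S] and [f] both vanish at [b], so
   their product is already in the square. *)
have -> : f = u * (A * (h * h) + B * (P * h) + 1 * (P * M)) + (1 - u * S) * f.
  have -> : A * (h * h) + B * (P * h) + 1 * (P * M) = S * f by rewrite e; ring.
  by ring.
apply: insqD; last exact: insq_gen Gg _ _.
apply: insqM; apply: insqD; first apply: insqD; apply: insqM.
all: by apply: insq_gen Gg _ _; rewrite ?evP0.
Qed.

(** Differentiation sends the square of (p, g) into (p, g); hence bad points are double roots modulo
    [p]. *)
Lemma bad_root f b : bad f b -> ev b f = 0 /\ ev b f^`() = 0.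
Proof.
move=> [g [Gg [A [B [C ->]]]]]; have g0 := ev_kernel_gen Gg.
rewrite !derivE !evE g0 intP0; split; ring.
Qed.

End ModP.

(** * Dedekind's criterion *)

(** This form of the index condition makes sense before the quotient is known to be finite. *)
Definition no_torsion (theta : algC) (p : nat) :=
  forall x, ZK theta x -> Ztheta theta (p%:R * x) -> Ztheta theta x.

(** [Aint] tests the coefficients of the minimal polynomial, whereas the arguments below produce or
    consume an arbitrary monic integral equation. *)
Lemma AintP (x : algC) : x \in Aint <-> integralOver (intr : int -> algC) x.
Proof.
split=> [/floorpP[q Dq]|[q mon_q qx]].
  have mon_q : q \is monic.
    have := minCpoly_monic x; rewrite Dq !monicE lead_coef_map_inj //; last exact: intr_inj.
    by rewrite -[1]/(1%:~R) eqr_int.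
  by exists q; rewrite // -Dq root_minCpoly.
apply: root_monic_Aint qx _ _; first exact: monic_map.
by apply/polyOverP=> i; rewrite coef_map /= intr_int.
Qed.

(** * The order Z[theta] and the integral elements of Q(theta) *)

Section Theta.
Variables (theta : algC) (f : {poly int}).
Hypotheses (mon_f : f \is monic)
  (irr_f : irreducible_poly (map_poly intr f : {poly rat}))
  (f_theta : root (map_poly intr f) theta).

Lemma map_ratr_intr (q : {poly int}) :
  map_poly ratr (map_poly intr q : {poly rat}) = map_poly intr q :> {poly algC}.
Proof.
by rewrite -map_poly_comp; apply: eq_map_poly => z /=; rewrite ratr_int.
Qed.

Lemma Qtheta_small_eq0 (r : {poly rat}) :
  (size r < size f)%N -> root (map_poly ratr r) theta -> r = 0.
Proof.
move=> lt_rf r0; apply/eqP; apply: contraT => nz_r.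
have : coprimep (map_poly intr f) r.
  rewrite irreducible_poly_coprime //; apply: contraL lt_rf => /(dvdp_leq nz_r).
  by rewrite size_map_inj_poly ?rmorph0 -?leqNgt //; apply: intr_inj.
rewrite -(coprimep_map (ratr : {rmorphism rat -> algC})) map_ratr_intr.
by move/coprimep_root/(_ f_theta); rewrite (rootP r0) eqxx.
Qed.

Lemma ev_theta0 : ev theta f = 0. Proof. exact/eqP. Qed.

(** Division by the monic [f] stays over the integers, and the remainder is too short to vanish at
    [theta] unless it is zero. *)
Lemma ev_theta_eq0 q : ev theta q = 0 <-> exists w, q = f * w.
Proof.
split=> [q0|[w ->]]; last by rewrite evM ev_theta0 mul0r.
exists (Pdiv.Ring.rdivp q f); rewrite {1}(Pdiv.RingMonic.rdivp_eq mon_f q).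
suff -> : Pdiv.Ring.rmodp q f = 0 by rewrite addr0 mulrC.
set r := Pdiv.Ring.rmodp q f.
apply: (map_inj_poly (intr_inj : injective (intr : int -> rat))); first by rewrite rmorph0.
rewrite rmorph0; apply: Qtheta_small_eq0.
  rewrite size_map_inj_poly ?rmorph0 //; last exact: intr_inj.
  by rewrite Pdiv.Ring.ltn_rmodp monic_neq0.
rewrite map_ratr_intr; apply/eqP; move: q0.
by rewrite {1}(Pdiv.RingMonic.rdivp_eq mon_f q) evD evM ev_theta0 mulr0 add0r.
Qed.

Lemma theta_Aint : theta \in Aint.
Proof.
apply: root_monic_Aint f_theta _ _; first exact: monic_map.
by apply/polyOverP=> i; rewrite coef_map /= intr_int.
Qed.

Lemma ev_Aint (x : algC) q : x \in Aint -> ev x q \in Aint.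
Proof.
move=> xA; rewrite /ev horner_coef rpred_sum // => i _.
by rewrite coef_map rpredM ?rpredX ?Aint_int.
Qed.

Lemma ZK_ev q : ZK theta (ev theta q).
Proof.
split; last exact/ev_Aint/theta_Aint.
by exists (map_poly intr q); rewrite map_ratr_intr.
Qed.

Lemma ZKD x y : ZK theta x -> ZK theta y -> ZK theta (x + y).
Proof.
move=> [[q ->] xA] [[r ->] yA]; split; last exact: rpredD.
by exists (q + r); rewrite rmorphD hornerD.
Qed.

Lemma ZKM x y : ZK theta x -> ZK theta y -> ZK theta (x * y).
Proof.
move=> [[q ->] xA] [[r ->] yA]; split; last exact: rpredM.
by exists (q * r); rewrite rmorphM hornerM.
Qed.

Lemma Qtheta_div q (d : nat) : Qtheta theta (ev theta q / d%:R).
Proof.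
exists (d%:R^-1 *: map_poly intr q).
by rewrite map_polyZ hornerZ map_ratr_intr /= fmorphV rmorph_nat mulrC.
Qed.

(* The minimal polynomial of [y = H(theta) / G(theta)], homogenised. *)
Lemma integral_fraction_pow y G H : y \in Aint -> ev theta G * y = ev theta H ->
  exists e W w, H ^+ e = G * W + f * w.
Proof.
move=> /AintP[mu mon_mu mu_y] GyH.
pose e := (size mu).-1.
have size_mu : size mu = e.+1 by rewrite prednK // size_poly_gt0 monic_neq0.
(* In G^e mu(y), the term of degree i becomes mu_i H^i G^(e - i); every term but the leading one
   contains [G], which is factored out once, hence the predecessor. *)
pose W := \sum_(i < e) (mu`_i)%:P * H ^+ i * G ^+ (e - i).-1.
have [|w Dw] := (ev_theta_eq0 (H ^+ e + G * W)).1; last first.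
  by exists e, (- W), w; rewrite -Dw; ring.
have : ev theta G ^+ e * (map_poly intr mu).[y] = 0 by rewrite (rootP mu_y) mulr0.
rewrite horner_coef size_map_inj_poly ?rmorph0 //; last exact: intr_inj.
rewrite size_mu big_ord_recr /= coef_map /=.
have -> : mu`_e = 1 by rewrite -[RHS](monicP mon_mu) lead_coefE.
rewrite mul1r mulrDr mulr_sumr -exprMn GyH addrC => e0.
rewrite -[RHS]e0 evD evXn evM; congr (_ + _).
rewrite /ev /W rmorph_sum horner_sum mulr_sumr; apply: eq_bigr => i _.
rewrite -/(ev _ _) -/(ev _ _) !evE -GyH coef_map /= exprMn.
case: i => i lt_ie /=; have De : (e = (e - i).-1 + 1 + i)%N by lia.
by rewrite [in RHS]De !exprD expr1; ring.
Qed.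

End Theta.

Section Dedekind.
Variables (p : nat) (K : closedFieldType) (FtoK : {rmorphism 'F_p -> K}).
Hypotheses (p_pr : prime p) (FtoK_alg : integralRange FtoK).
Variables (theta : algC) (f : {poly int}).
Hypotheses (mon_f : f \is monic)
  (irr_f : irreducible_poly (map_poly intr f : {poly rat}))
  (f_theta : root (map_poly intr f) theta).
Local Notation P := ((p%:Z)%:P : {poly int}).

Lemma natp_neq0 : p%:R != 0 :> algC.
Proof. by rewrite pnatr_eq0 -lt0n prime_gt0. Qed.

Lemma bad_torsion (b : K) : bad p f b -> ~ no_torsion theta p.
Proof.
move=> [g [[irr_g _] [A [B [C Df]]]]] notors.
pose h := g * A + P * B; pose y := ev theta h / p%:R.
have yh : p%:R * y = ev theta h by rewrite mulrC divfK ?natp_neq0.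
have yA : y \in Aint.
  pose Q : {poly algC} := 'X * ('X - (ev theta B)%:P) + (ev theta C * ev theta A)%:P.
  have QA : Q \is a polyOver Aint.
    have evA q : ev theta q \in Aint by exact/ev_Aint/(theta_Aint mon_f f_theta).
    by rewrite rpredD ?rpredM ?rpredB ?polyOverX ?polyOverC ?rpredM.
  apply/AintP/(@integral_root_monic _ _ _ _ Q).
  - have szX : size ('X * ('X - (ev theta B)%:P)) = 3%N.
      by rewrite mulrC size_mulX ?polyXsubC_eq0 // size_XsubC.
    rewrite monicE lead_coefDl; last by rewrite szX (leq_ltn_trans (size_polyC_leq1 _)).
    by rewrite lead_coefM lead_coefX lead_coefXsubC mulr1.
  (* Clearing denominators, p^2 Q(y) = A(theta) f(theta) = 0. *)
  - apply/rootP/(mulfI natp_neq0)/(mulfI natp_neq0).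
    rewrite hornerD hornerM hornerX hornerXsubC hornerC.
    have -> : p%:R * (p%:R * (y * (y - ev theta B) + ev theta C * ev theta A)) =
      p%:R * y * (p%:R * y - p%:R * ev theta B) + p%:R * p%:R * ev theta C * ev theta A by ring.
    rewrite yh; have -> : p%:R = ev theta P by rewrite evC.
    transitivity (ev theta A * ev theta f); first by rewrite Df /h !evE; ring.
    by rewrite (ev_theta0 f_theta) !mulr0.
  - by move=> x /(nthP 0)[i _ <-]; apply/AintP/(polyOverP QA).
have [] := notors y; first by split=> //; apply: Qtheta_div.
  by exists h.
(* If [y] were z(theta), then h = f w and f = g h modulo [p], so g w = 1 and [g] would be constant
   modulo [p]. *)
move=> z yz; have [w Dw] : exists w, h - P * z = f * w.
  apply/(ev_theta_eq0 mon_f irr_f f_theta); rewrite evD evN evM evC -yh.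
  by rewrite yz -/(ev theta z) -pmulrn subrr.
have Dh : redp p h = redp p f * redp p w.
  by have /(congr1 (redp p)) := Dw; rewrite !redpE rmorphB !rmorphM /= -!redpE redpP // mul0r subr0.
have Df' : redp p f = redp p g * redp p h.
  have -> : f = g * h + P * (P * C) by rewrite Df /h; ring.
  by rewrite !redpE rmorphD !rmorphM /= -!redpE redpP // mul0r addr0.
have nz_f : redp p f != 0 by rewrite monic_neq0 ?redpE ?monic_map.
have nz_h : redp p h != 0 by apply: contraNneq nz_f => h0; rewrite Df' h0 mulr0.
have : redp p g %| 1.
  apply/dvdpP; exists (redp p w); apply: (mulfI nz_h).
  by rewrite mulr1 {1}Dh Df'; ring.
by rewrite dvdp1 => /eqP sz1; case: irr_g; rewrite sz1.
Qed.

Lemma torsion_free : (forall b : K, ~ bad p f b) -> no_torsion theta p.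
Proof.
move=> nobad x xZK [q pxq].
have [/dvdpP[w'] | ndv] := boolP (redp p f %| redp p q).
  have [w <-] := redp_lift w' => e.
  have [|z Dz] := @redp_eq0 p p_pr (q - w * f).
    by rewrite redpE rmorphB rmorphM /= -!redpE e subrr.
  exists z; apply: (mulfI natp_neq0); rewrite pxq -/(ev theta q) -/(ev theta z).
  have -> : q = P * z + w * f by rewrite -Dz; ring.
  by rewrite !evE (ev_theta0 f_theta) mulr0 addr0.
(* [H] lifts the gcd of [q] and [f] modulo [p]. As H(theta) = U(theta) q(theta), the quotient
   H(theta) / p = U(theta) x is integral. *)
exfalso; have [[u' v'] /= eqh] := Bezoutp (redp p q) (redp p f).
have [U DU] := redp_lift u'; have [V DV] := redp_lift v'.
pose H := U * q + V * f.
have DH : redp p H = u' * redp p q + v' * redp p f.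
  by rewrite /H redpE rmorphD !rmorphM /= -!redpE DU DV.
rewrite -DH in eqh.
have hf : redp p H %| redp p f by rewrite (eqp_dvdl _ eqh) dvdp_gcdr.
have hq : redp p H %| redp p q by rewrite (eqp_dvdl _ eqh) dvdp_gcdl.
have nz_f : redp p f != 0 by rewrite monic_neq0 ?redpE ?monic_map.
case/dvdpP: hf => g1'; have [G1 <-] := redp_lift g1' => Df.
(* The cofactor [G1] of [H] in [f] is not constant modulo [p], since otherwise [f] would divide [H],
   hence [q]; so it has a root [b]. *)
have szG : size (map_poly FtoK (redp p G1)) != 1%N.
  rewrite size_map_poly; apply: contra ndv => sz1.
  apply: dvdp_trans hq; rewrite Df -{2}[redp p H]mul1r dvdp_mul2r.
    by rewrite dvdp1.
  by apply: contraNneq nz_f => H0; rewrite Df H0 mulr0.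
have /closed_rootP[b /rootP] := szG; rewrite map_redp -/(ev b G1) => G1b.
have [M0 DM0] : exists M0, f - G1 * H = P * M0.
  by apply: redp_eq0; rewrite // redpE rmorphB rmorphM /= -!redpE Df subrr.
have [g Gg] := kernel_gen_exists p_pr FtoK_alg b; have [_ Gg'] := Gg.
have [w [z DG1]] := (Gg' G1).1 G1b.
pose h := w * H; pose M := z * H + M0.
have Df2 : f = g * h + P * M.
  have -> : f = G1 * H + P * M0 by rewrite -DM0; ring.
  by rewrite DG1 /h /M; ring.
pose y := ev theta (w * U) * x.
have yZK : ZK theta y by apply: ZKM xZK; apply: ZK_ev mon_f f_theta _.
have pyh : ev theta P * y = ev theta h.
  rewrite evC -pmulrn /y mulrCA pxq -/(ev theta q) /h /H !evE (ev_theta0 f_theta); ring.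
have fb : ev b f = 0.
  by rewrite -[f](subrK (G1 * H)) DM0 !evD !evM G1b evC (intP0 FtoK p_pr) !mul0r addr0.
(* If y = X(theta) / G(theta), some power of [X] lies in the ideal (G, f), so [X] vanishes at [b] as
   soon as [G] does. Used for the two expressions h / p and - M / g of [y]. *)
have frac G X : ev theta G * y = ev theta X -> ev b G = 0 -> ev b X = 0.
  move=> e Gb; have [i [W [w' e']]] :=
    integral_fraction_pow mon_f irr_f f_theta yZK.2 e.
  apply/eqP; have /eqP : ev b X ^+ i = 0 by rewrite -evXn e' !evE Gb fb; ring.
  by rewrite expf_eq0 => /andP[].
have hb : ev b h = 0 by apply: frac pyh _; rewrite (evP0 FtoK).
have Mb : ev b (- M) = 0.
  apply: (@frac g); last exact: ev_kernel_gen Gg.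
  apply: (mulfI natp_neq0); rewrite mulrCA pmulrn -(evC theta) pyh.
  have := ev_theta0 f_theta; rewrite {1}Df2 !evE => /eqP.
  by rewrite addr_eq0 mulrN => /eqP.
have {}Mb : ev b M = 0 by apply/eqP; rewrite -oppr_eq0 -evN Mb.
apply: (nobad b); exists g; split=> //; rewrite Df2.
apply: insqD; apply: (insq_gen Gg) => //; first exact: ev_kernel_gen Gg.
exact: (evP0 FtoK).
Qed.

End Dedekind.

(** * The index and p-torsion *)

(** Translation by [x] permutes the [d] classes with order dividing [p]. The number of fixed classes
    is congruent to [d] modulo [p], hence nonzero, and a fixed class puts [x] in Z[theta]. *)
Lemma no_torsion_of_index theta p : prime p ->
  p_not_dvd_index theta p -> no_torsion theta p.
Proof.
move=> p_pr [d [[s [sz_s sZK s_inj s_cov]] pd]] x xZK [q px].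
have ZD y z : Ztheta theta y -> Ztheta theta z -> Ztheta theta (y + z).
  by move=> [u ->] [v ->]; exists (u + v); rewrite -!/(ev _ _) evD.
have ZN y : Ztheta theta y -> Ztheta theta (- y).
  by move=> [u ->]; exists (- u); rewrite -!/(ev _ _) evN.
have s_eq (i j : 'I_d) : Ztheta theta (s`_i - s`_j) -> i = j.
  move=> h; apply/eqP/negPn/negP=> /eqP ij; apply: (s_inj i j) h => // /val_inj.
  exact: ij.
have [T DT] : exists T : 'I_d -> 'I_d, forall i : 'I_d, Ztheta theta (s`_i + x - s`_(T i)).
  apply: (@fin_all_exists _ (fun=> 'I_d) (fun i j : 'I_d => Ztheta theta (s`_i + x - s`_j))) => i; have [|j ltj h] := s_cov (s`_i + x).
    by apply: ZKD xZK; apply: sZK; rewrite mem_nth ?sz_s.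
  by exists (Ordinal ltj).
have T_inj : injective T.
  move=> i j eT; apply: s_eq; have := ZD _ _ (DT i) (ZN _ (DT j)).
  rewrite eT; congr (Ztheta _ _); ring.
pose sg := perm T_inj.
have sgX m (i : 'I_d) : Ztheta theta (s`_i + m%:R * x - s`_((sg ^+ m)%g i)).
  elim: m => [|m IH]; first by rewrite expg0 perm1 mul0r addr0 subrr; exists 0; rewrite -/(ev _ _) ev0.
  rewrite expgSr permM permE; have := ZD _ _ IH (DT ((sg ^+ m)%g i)).
  congr (Ztheta _ _); rewrite -natr1; ring.
have sgp : (sg ^+ p = 1)%g.
  apply/permP=> i; rewrite perm1; apply/esym/s_eq; have := sgX p i => h.
  have := ZD _ _ h (ZN _ (ex_intro _ q px)); congr (Ztheta _ _); ring.
have pG : (p.-group <[sg]>)%g.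
  rewrite /pgroup -orderE; apply: (@pnat_dvd _ p); last exact: pnat_id.
  by rewrite order_dvdn sgp.
have acts : [acts <[sg]>, on [set: 'I_d] | 'P]%g.
  by apply/actsP=> a _ i; rewrite !inE.
have := pgroup_fix_mod pG acts; rewrite cardsT card_ord setTI afix_cycle ?inE //.
have [-> /eqP|[i]] := set_0Vmem 'Fix_'P[sg]%g.
  by rewrite cards0 mod0n -/(dvdn _ _) (negPf pd).
move/afix1P; rewrite /= apermE permE => Ti _.
by have := DT i; rewrite Ti addrAC subrr add0r.
Qed.

Lemma size_deriv_int (g : {poly int}) : size g^`() = (size g).-1.
Proof.
have [g1|g1] := leqP (size g) 1.
  by rewrite [g]size1_polyC // derivC size_poly0 size_polyC; case: eqP.
rewrite /deriv size_poly_eq //.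
have -> : (size g).-2.+1 = (size g).-1 by lia.
rewrite -lead_coefE mulrn_eq0 lead_coef_eq0 -size_poly_eq0. by case: (size g) g1 => [|[|]].
Qed.

(** * A common denominator for the algebraic integers of Q(theta) *)

Section Denominator.
Variables (theta : algC) (f : {poly int}).
Hypotheses (mon_f : f \is monic) (size_f : (2 < size f)%N)
  (irr_f : irreducible_poly (map_poly intr f : {poly rat}))
  (f_theta : root (map_poly intr f) theta).

Let intQ_inj : injective (intr : int -> rat) := intr_inj.

Lemma coprime_deriv_rat :
  coprimep (map_poly intr f : {poly rat}) (map_poly intr f)^`().
Proof.
rewrite irreducible_poly_coprime // deriv_map; apply/negP=> /dvdp_leq.
rewrite -size_poly_gt0 !size_map_inj_poly ?rmorph0 // size_deriv_int.
by case: (size f) size_f => [|[|[|m]]] // _ /(_ isT); rewrite ltnn.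
Qed.

(** The gcd over the integers remains a common divisor over the rationals, where irreducibility
    makes [f] and its derivative coprime. *)
Lemma resultant_deriv_neq0 : resultant f f^`() != 0.
Proof.
rewrite resultant_eq0 -leqNgt.
have dvdQ g h : Pdiv.Idomain.dvdp g h ->
    map_poly (intr : int -> rat) g %| map_poly intr h.
  move=> /Pdiv.Idomain.dvdpP[[c' q] /= nz_c Dh].
  rewrite -(@dvdpZr _ (c'%:~R : rat)) ?intr_eq0 //.
  by rewrite -map_polyZ Dh rmorphM /= dvdp_mull.
set g := gcdp f _.
have := coprime_deriv_rat; rewrite coprimep_def => /eqP e.
rewrite -(size_map_inj_poly intQ_inj) ?rmorph0 // -[1%N]e.
apply: dvdp_leq; first by rewrite -size_poly_eq0 e.
by rewrite dvdp_gcd deriv_map !dvdQ ?dvdp_gcdl ?dvdp_gcdr.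
Qed.

Lemma resultant_deriv_ideal :
  exists U V, (resultant f f^`())%:P = U * f + V * f^`().
Proof.
have f1 : (1 < size f)%N by apply: ltnW.
have df1 : (1 < size f^`())%N.
  by rewrite size_deriv_int; case: (size f) size_f => [|[|[|]]].
by have [[U V] /= _ e] := resultant_in_ideal f1 df1; exists U, V.
Qed.

Lemma Qtheta_reduce (q : {poly rat}) : exists2 r : {poly rat},
  (size r < size f)%N & exists w, q = w * map_poly intr f + r.
Proof.
exists (q %% map_poly intr f); last by exists (q %/ map_poly intr f); apply: divp_eq.
rewrite -(size_map_inj_poly intQ_inj) ?rmorph0 // ltn_modp.
by rewrite map_poly_eq0_id0 ?lead_coef_eq0 ?monic_neq0 // (monicP mon_f).
Qed.

Lemma dvd_root_theta (q : {poly rat}) : root (map_poly ratr q) theta ->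
  exists w, q = w * map_poly intr f.
Proof.
move=> q0; have [r lt_rf [w Dq]] := Qtheta_reduce q; exists w.
rewrite Dq (_ : r = 0) ?addr0 //; apply: (Qtheta_small_eq0 irr_f f_theta lt_rf).
have := rootP q0; rewrite Dq rmorphD rmorphM hornerD hornerM /= map_ratr_intr.
by rewrite (rootP f_theta) mulr0 add0r => /rootP.
Qed.

(* Lagrange interpolation at the conjugates of [theta]: if [D = U f + V f'],
   then [D q(X)] is the sum over the roots [z] of [f] of
   [q(z) V(z) f(X) / (X - z)], whose coefficients are algebraic integers. *)
Lemma common_denominator : exists2 D : nat, (1 < D)%N & forall x, ZK theta x ->
  exists2 q : {poly int}, (size q < size f)%N & D%:R * x = ev theta q.
Proof.
have [U [V DUV]] := resultant_deriv_ideal; set D := resultant _ _ in DUV.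
suff HD x : ZK theta x -> exists2 q : {poly int}, (size q < size f)%N & D%:~R * x = ev theta q.
  (* The factor 2 keeps the denominator above 1, where ['Z_D] is really the ring Z/D. *)
  exists (`|D| * 2)%N; first by have := resultant_deriv_neq0; rewrite -/D; lia.
  move=> x /HD[q sz_q e]; exists ((sgz D * 2)%:P * q).
    rewrite mul_polyC; exact: leq_ltn_trans (size_scale_leq _ _) sz_q.
  rewrite evM -e evC mulrA; congr (_ * _).
  rewrite pmulrn -intrM; congr (_%:~R); rewrite PoszM abszE -[in LHS]/(2%:Z).
  by rewrite -[X in `|X|]mulr1 normrEsg; lia.
move=> [[q0 ->] xA].
have [q sz_q [w0 Dq]] := Qtheta_reduce q0.
have ev_q : (map_poly ratr q0).[theta] = (map_poly ratr q).[theta].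
  rewrite Dq rmorphD rmorphM hornerD hornerM /= map_ratr_intr.
  by rewrite (rootP f_theta) mulr0 add0r.
rewrite ev_q in xA *; set qC := map_poly ratr q in xA *.
have [r Df] := closed_field_poly_normal (map_poly intr f : {poly algC}).
have mon_fC : map_poly (intr : int -> algC) f \is monic by exact: monic_map.
rewrite (monicP mon_fC) scale1r in Df.
have uniq_r : uniq r.
  rewrite -separable_prod_XsubC -Df unlock -map_ratr_intr deriv_map.
  by rewrite coprimep_map coprime_deriv_rat.
have r_root z : z \in r -> ev z f = 0.
  by move=> zr; apply/rootP; rewrite Df root_prod_XsubC.
have r_A z : z \in r -> z \in Aint.
  move=> /r_root fz; apply/AintP; exists f => //; exact/rootP.
(* A monic integer polynomial [mu] vanishing at q(theta) has [mu \Po q] divisible by [f], so [mu]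
   also vanishes at every conjugate q(z). *)
have q_A z : z \in r -> qC.[z] \in Aint.
  have /AintP[mu mon_mu /rootP mux] := xA.
  have [|v Dv] := @dvd_root_theta (map_poly intr mu \Po q).
    by apply/rootP; rewrite map_comp_poly horner_comp map_ratr_intr.
  move=> zr; apply/AintP; exists mu => //; apply/rootP.
  rewrite -map_ratr_intr /qC -horner_comp -map_comp_poly Dv rmorphM hornerM /=.
  by rewrite map_ratr_intr [X in _ * X](r_root _ zr) mulr0.
pose G z := \prod_(w <- rem z r) ('X - w%:P : {poly algC}).
pose E := \sum_(z <- r) (qC.[z] * ev z V) *: G z.
have DfG z : z \in r -> map_poly intr f = ('X - z%:P) * G z.
  by move=> zr; rewrite Df (perm_big _ (perm_to_rem zr)) big_cons.
have df z : z \in r -> ev z f^`() = (G z).[z].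
  move=> zr; rewrite /ev -deriv_map (DfG z zr) derivM derivXsubC mul1r hornerD hornerM.
  by rewrite hornerXsubC subrr mul0r addr0.
have sz_r : (size r).+1 = size f.
  by rewrite -(size_prod_XsubC r id) -Df size_map_inj_poly ?rmorph0 //; apply: intr_inj.
(* Both polynomials are shorter than [f] and agree at its distinct roots: at z only the term of z
   survives, and G_z(z) = f'(z). *)
have E_eq : D%:~R *: qC - E = 0.
  apply: (@roots_geq_poly_eq0 _ _ r) => //.
    apply/allP=> z zr; apply/rootP; rewrite hornerD hornerN hornerZ /E horner_sum.
    rewrite (perm_big _ (perm_to_rem zr)) big_cons /= big_seq big1 => [|w].
      rewrite addr0 hornerZ -df //.
      have : D%:~R = ev z V * ev z f^`().
        by rewrite -(evC z) DUV evD !evM (r_root z zr) mulr0 add0r.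
      by move=> ->; ring.
    rewrite mem_rem_uniq // => /andP[/= wz wr]; rewrite hornerZ.
    have /rootP -> : root (G w) z; last by rewrite mulr0.
    by rewrite root_prod_XsubC mem_rem_uniq // inE /= eq_sym wz.
  rewrite (leq_trans (size_polyD _ _)) // geq_max size_polyN; apply/andP; split.
    by rewrite (leq_trans (size_scale_leq _ _)) // size_map_poly -ltnS sz_r.
  rewrite (leq_trans (size_sum _ _ _)) //; apply/bigmax_leqP_seq=> z zr _.
  by rewrite (leq_trans (size_scale_leq _ _)) // size_prod_XsubC size_rem // prednK // -has_predT; apply/hasP; exists z.
have EA : E \is a polyOver Aint.
  rewrite /E big_seq rpred_sum // => z zr; rewrite polyOverZ //.
    by rewrite rpredM ?q_A ?ev_Aint ?r_A.
  rewrite /G big_seq rpred_prod // => w /mem_rem wr.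
  by rewrite rpredB ?polyOverX ?polyOverC ?r_A.
(* The coefficients are rational and algebraic integers, hence integers. *)
have /floorpP[Q DQ] : D%:~R *: qC \is a polyOver Num.int.
  apply/polyOverP=> i; apply: Cint_rat_Aint.
    by rewrite coefZ coef_map rpredM ?rpred_int ?Crat_rat.
  by have /eqP := E_eq; rewrite subr_eq0 => /eqP->; apply: (polyOverP EA).
exists Q; last by rewrite -hornerZ DQ.
rewrite -(size_map_inj_poly (intr_inj : injective (intr : int -> algC))) ?rmorph0 // -DQ.
by rewrite (leq_ltn_trans (size_scale_leq _ _)) // size_map_poly.
Qed.

End Denominator.

(** * Finiteness of the quotient and comparison of its order with torsion *)

Section Index.
Variables (theta : algC) (f : {poly int}).
Hypotheses (mon_f : f \is monic) (size_f : (2 < size f)%N)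
  (irr_f : irreducible_poly (map_poly intr f : {poly rat}))
  (f_theta : root (map_poly intr f) theta).

(* [ZK / Z[theta]] is realised as the subgroup of [(Z/D)^N] of the vectors [v]
   such that [v(theta) / D] is an algebraic integer. *)
Section Residues.
Variable D : nat.
Hypothesis D_gt1 : (1 < D)%N.
Local Notation N := (size f).-1.

Definition lift_rV (v : 'rV['Z_D]_N) : {poly int} :=
  rVpoly (map_mx (fun x : 'Z_D => (x : nat)%:Z) v).

Lemma intr_Zp_eq0 (z : int) : (z%:~R == 0 :> 'Z_D) = (D %| z)%Z.
Proof.
have ZpE n : (n%:R == 0 :> 'Z_D) = (D %| n)%N.
  by rewrite -val_eqE /= val_Zp_nat.
case: z => n; first by rewrite -pmulrn ZpE.
by rewrite NegzE mulrNz oppr_eq0 -pmulrn ZpE dvdzE abszN.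
Qed.

Lemma lift_rV_coef v (i : 'I_N) : ((lift_rV v)`_i)%:~R = v 0 i.
Proof. by rewrite /lift_rV coef_rVpoly_ord mxE -pmulrn natr_Zp. Qed.

Lemma lift_rV_eq (v : 'rV['Z_D]_N) (q : {poly int}) : (size q < size f)%N ->
  (forall i : 'I_N, (q`_i)%:~R = v 0 i) ->
  exists s, q = lift_rV v + D%:Z%:P * s.
Proof.
move=> sz_q qv; exists (map_poly (fun z => z %/ D)%Z (q - lift_rV v)).
rewrite addrC; apply/eqP; rewrite -subr_eq; apply/eqP/polyP=> i.
rewrite coefCM coef_map_id0 ?div0z // mulrC divzK // -intr_Zp_eq0.
rewrite coefB intrB; have [ltiN | leNi] := ltnP i N.
  by rewrite (qv (Ordinal ltiN)) (lift_rV_coef v (Ordinal ltiN)) subrr.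
rewrite !nth_default ?subrr //; apply: leq_trans leNi; first exact: size_poly.
by case: (size f) sz_q.
Qed.

Lemma size_lift_rV v : (size (lift_rV v) < size f)%N.
Proof. by apply: leq_ltn_trans (size_poly _ _) _; rewrite prednK // (ltn_trans _ size_f). Qed.

Lemma D_neq0 : D%:R != 0 :> algC.
Proof. by rewrite pnatr_eq0 -lt0n ltnW. Qed.

Definition rV_frac v : algC := ev theta (lift_rV v) / D%:R.

Lemma rV_frac_reduce (v : 'rV['Z_D]_N) (q : {poly int}) : (size q < size f)%N ->
  (forall i : 'I_N, (q`_i)%:~R = v 0 i) ->
  exists s, ev theta q / D%:R = rV_frac v + ev theta s.
Proof.
move=> sz_q qv; have [s ->] := lift_rV_eq sz_q qv; exists s.
by rewrite /rV_frac !evE mulrDl -pmulrn mulrAC divff ?D_neq0 // mul1r.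
Qed.

(** If the difference is z(theta), reduce z modulo [f] to [r]: then
    [lift_rV v - lift_rV w - D%:Z%:P * r] is a multiple of [f] shorter than [f], hence zero, and the
    coordinates agree modulo [D]. *)
Lemma rV_frac_inj v w : Ztheta theta (rV_frac v - rV_frac w) -> v = w.
Proof.
move=> [z]; rewrite -/(ev _ _) => e.
have [u Du] : exists u, lift_rV v - lift_rV w - D%:Z%:P * z = f * u.
  apply/(ev_theta_eq0 mon_f irr_f f_theta); rewrite evD evN evM evC -e -pmulrn.
  rewrite /rV_frac -mulrBl mulrC divfK ?D_neq0 // !evE; ring.
pose r := Pdiv.Ring.rmodp z f.
have Dz := Pdiv.RingMonic.rdivp_eq mon_f z; rewrite -/r in Dz.
set z0 := Pdiv.Ring.rdivp z f in Dz.
have lt_r : (size r < size f)%N by rewrite Pdiv.Ring.ltn_rmodp monic_neq0.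
pose g := lift_rV v - lift_rV w - D%:Z%:P * r.
have Dg : g = f * (u + D%:Z%:P * z0).
  by rewrite mulrDr -Du {1}Dz /g; ring.
have sz_g : (size g < size f)%N.
  rewrite (leq_ltn_trans (size_polyD _ _)) // gtn_max size_polyN; apply/andP; split.
    rewrite (leq_ltn_trans (size_polyD _ _)) // gtn_max size_polyN.
    by rewrite !size_lift_rV.
  by rewrite mul_polyC (leq_ltn_trans (size_scale_leq _ _)).
have g0 : g = 0.
  have [u0|nz] := eqVneq (u + D%:Z%:P * z0) 0; first by rewrite Dg u0 mulr0.
  move: nz sz_g; rewrite -size_poly_gt0 Dg => nz; rewrite size_monicM -?size_poly_gt0 //.
  move: nz; move: (size _) => m; lia.
apply/rowP=> i; rewrite -!lift_rV_coef; apply/eqP; rewrite -subr_eq0 -intrB intr_Zp_eq0.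
have /polyP/(_ i) := g0; rewrite /g !coefB coefCM coef0 => /eqP.
by rewrite subr_eq0 => /eqP->; apply: dvdz_mulr.
Qed.

Definition Aint_residues := [set v | rV_frac v \in Aint].

Lemma lift_rV0 : lift_rV 0 = 0.
Proof.
apply/polyP=> i; rewrite coef_poly coef0; case: ifP => // _.
by case: insub => // j; rewrite !mxE.
Qed.

Lemma Aint_residues_group : group_set Aint_residues.
Proof.
apply/group_setP; split=> [|v w]; first by rewrite inE /rV_frac lift_rV0 ev0 mul0r.
rewrite !inE => vA wA.
(* The group law is addition of row vectors; the carries modulo [D] contribute only the element
   s(theta). *)
have [||s] := @rV_frac_reduce (v * w)%g (lift_rV v + lift_rV w).
- by rewrite (leq_ltn_trans (size_polyD _ _)) // gtn_max !size_lift_rV.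
- by move=> i; rewrite coefD intrD !lift_rV_coef FinRing.zmodMgE mxE.
rewrite evD mulrDl -!/(rV_frac _) => /eqP; rewrite -subr_eq => /eqP <-.
by rewrite rpredB ?rpredD // ev_Aint // (theta_Aint mon_f f_theta).
Qed.

Canonical Aint_residues_Group := Group Aint_residues_group.

Lemma rV_frac_ZK v : v \in Aint_residues -> ZK theta (rV_frac v).
Proof. by rewrite inE; split=> //; apply: Qtheta_div. Qed.

Lemma residues_index : (forall x, ZK theta x ->
    exists2 q : {poly int}, (size q < size f)%N & D%:R * x = ev theta q) ->
  ZK_index_is theta #|Aint_residues|.
Proof.
move=> denom; exists [seq rV_frac v | v <- enum Aint_residues].
have sz : size [seq rV_frac v | v <- enum Aint_residues] = #|Aint_residues|.
  by rewrite size_map -cardE.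
split=> //.
- by move=> x /mapP[v]; rewrite mem_enum => vA ->; apply: rV_frac_ZK.
- move=> i j ltid ltjd ij; rewrite !(nth_map 0) -?cardE // => /rV_frac_inj /eqP.
  by rewrite nth_uniq ?enum_uniq -?cardE // => /eqP.
move=> x xZK; have [q sz_q Dx] := denom x xZK.
pose v : 'rV['Z_D]_N := \row_i (q`_i)%:~R.
have [|s] := @rV_frac_reduce v q sz_q; first by move=> i; rewrite mxE.
rewrite -Dx mulrAC divff ?D_neq0 // mul1r => xs.
have vA : v \in Aint_residues.
  rewrite inE -[rV_frac v](addrK (ev theta s)) -xs rpredB ?(ev_Aint _ (theta_Aint mon_f f_theta)) //.
  by case: xZK.
exists (index v (enum Aint_residues)); first by rewrite cardE index_mem mem_enum.
rewrite (nth_map 0) ?index_mem ?mem_enum // nth_index ?mem_enum //.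
by exists s; rewrite xs addrAC subrr add0r.
Qed.

(** By Cauchy, a group of order divisible by [p] has an element of order [p], that is, a [p]-torsion
    class. *)
Lemma residues_torsion p : prime p -> no_torsion theta p -> ~~ (p %| #|Aint_residues|)%N.
Proof.
move=> p_pr notors; apply/negP=> /(Cauchy p_pr)[v vA ov].
have [||s e] := @rV_frac_reduce 0 (p%:Z%:P * lift_rV v).
- by rewrite mul_polyC (leq_ltn_trans (size_scale_leq _ _)) ?size_lift_rV.
- move=> i; rewrite coefCM intrM lift_rV_coef -pmulrn mulr_natl.
  have : (v *+ p = 0)%R by rewrite -FinRing.zmodXgE -ov; apply: expg_order.
  by move=> /rowP/(_ i); rewrite mulmxnE.
have /rV_frac_inj v0 : Ztheta theta (rV_frac v - rV_frac 0).
  rewrite {2}/rV_frac lift_rV0 ev0 mul0r subr0; apply: notors; first exact: rV_frac_ZK.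
  exists s; move: e; rewrite {1}/rV_frac lift_rV0 !evE mul0r add0r -/(ev _ _) => <-.
  by rewrite /rV_frac -pmulrn mulrA.
by move: ov p_pr; rewrite v0 order1 => <-.
Qed.

End Residues.

Lemma p_not_dvd_indexP p : prime p -> p_not_dvd_index theta p <-> no_torsion theta p.
Proof.
move=> p_pr; split=> [|notors]; first exact: no_torsion_of_index.
have [D D_gt1 denom] := common_denominator mon_f size_f irr_f f_theta.
exists #|Aint_residues D|; split; first exact: residues_index.
exact: residues_torsion.
Qed.

(** Strong induction on [D], removing one prime factor at a time. *)
Lemma Ztheta_of_multiple x D : (forall p, prime p -> no_torsion theta p) ->
  ZK theta x -> (0 < D)%N -> Ztheta theta (D%:R * x) -> Ztheta theta x.
Proof.
move=> notors; have [m] := ubnP D; elim: m D x => // m IH D x leDm xZK D_gt0 h.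
have [D1|D_gt1] := leqP D 1.
  have D1' : D = 1%N by apply/eqP; rewrite eqn_leq D1.
  by move: h; rewrite D1' mul1r.
have p_pr := pdiv_prime D_gt1; set p := pdiv D in p_pr.
have DD : D = (p * (D %/ p))%N by rewrite mulnC divnK ?pdiv_dvd.
apply: (IH (D %/ p)%N) => //.
- by rewrite -ltnS (leq_trans _ leDm) // ltnS ltn_Pdiv // prime_gt1.
- by rewrite divn_gt0 ?prime_gt0 // dvdn_leq // pdiv_dvd.
apply: (notors p p_pr).
  apply: ZKM xZK; have := ZK_ev mon_f f_theta ((D %/ p)%:Z%:P).
  by rewrite evC -pmulrn.
by rewrite mulrA -natrM -DD.
Qed.

Lemma ZK_eq_Ztheta : (forall p, prime p -> no_torsion theta p) <->
  (forall x, ZK theta x <-> Ztheta theta x).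
Proof.
split=> [notors x|eqZ p p_pr x xZK _]; last by apply/eqZ.
split=> [xZK|[q ->]]; last exact: (ZK_ev mon_f f_theta q).
have [D D_gt1 denom] := common_denominator mon_f size_f irr_f f_theta.
apply: (Ztheta_of_multiple notors xZK (ltnW D_gt1)).
by have [q _ ->] := denom x xZK; exists q.
Qed.

End Index.

(** * Expansions, binomial systems, discriminant *)

Lemma expD_taylor (R : comNzRingType) (h b : R) q :
  exists A, (h + b) ^+ q = b ^+ q + q%:R * b ^+ q.-1 * h + h * h * A.
Proof.
elim: q => [|[|q] [A IH]]; first by exists 0; rewrite !expr0; ring.
  by exists 0; rewrite !expr1 expr0; ring.
exists (A * (h + b) + q.+1%:R * b ^+ q); rewrite exprSr IH /= -[q.+2%:R]natr1 !exprSr.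
ring.
Qed.

(** The coefficient q b^(q - 1) of the linear term is a multiple of [p]. *)
Lemma expD_taylor_dvd (h b : {poly int}) p q : (p %| q)%N ->
  exists A B, (h + b) ^+ q = b ^+ q + p%:Z%:P * h * B + h * h * A.
Proof.
case/dvdnP=> r ->; have [A ->] := expD_taylor h b (r * p)%N.
exists A, (r%:R * b ^+ (r * p).-1); rewrite natrM.
by rewrite -(rmorph_nat polyC p) natz; ring.
Qed.

Lemma system_solvable (K : closedFieldType) (n r : nat) (d a : K) :
  (0 < n)%N -> (0 < r)%N -> d != 0 -> a != 0 ->
  (exists x, x ^+ n = d /\ x ^+ r = a) <->
  d ^+ (r %/ gcdn n r) = a ^+ (n %/ gcdn n r).
Proof.
move=> n_gt0 r_gt0 nz_d nz_a.
have t_gt0 : (0 < gcdn n r)%N by rewrite gcdn_gt0 n_gt0.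
have Dn := divnK (dvdn_gcdl n r); have Dr := divnK (dvdn_gcdr n r).
have co : coprime (n %/ gcdn n r) (r %/ gcdn n r).
  by rewrite /coprime -(eqn_pmul2r t_gt0) muln_gcdl Dn Dr mul1n.
move: (gcdn n r) (n %/ _)%N (r %/ _)%N t_gt0 Dn Dr co => t n1 r1 t_gt0 Dn Dr co.
split=> [[x [<- <-]]|e].
  by rewrite -!exprM; congr (x ^+ _); rewrite -Dn -Dr mulnAC [RHS]mulnAC (mulnC n1).
have n1_gt0 : (0 < n1)%N by case: n1 Dn {co e} => // n0; rewrite -n0 in n_gt0.
have [u v euv _] := egcdnP r1 n1_gt0.
rewrite (eqP co) in euv.
(* Since u n1 = v r1 + 1, any solution has x^t = d^u / a^v; conversely a t-th root of this [y] is a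
   solution. *)
pose y := d ^+ u / a ^+ v.
have y_n : y ^+ n1 = d.
  rewrite expr_div_n -!exprM euv [(v * n1)%N]mulnC (exprM a) -e -exprM.
  by rewrite [(r1 * v)%N]mulnC exprD expr1 mulrAC divff ?mul1r // expf_neq0.
have y_r : y ^+ r1 = a.
  rewrite expr_div_n -!exprM [(u * r1)%N]mulnC (exprM d) e -exprM.
  by rewrite [(n1 * u)%N]mulnC euv exprD expr1 mulrAC divff ?mul1r // expf_neq0.
have [|x] := @closed_rootP _ ('X^t - y%:P) _; first by rewrite size_XnsubC // eqSS -lt0n.
rewrite /root !hornerE subr_eq0 => /eqP xt.
by exists x; rewrite -Dn -Dr ![(_ * t)%N]mulnC !exprM xt.
Qed.

Section PrimeField.
Variables (p : nat) (K : closedFieldType) (FtoK : {rmorphism 'F_p -> K}).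
Hypotheses (p_pr : prime p).

Lemma coprimep_closure (a b : {poly 'F_p}) : coprimep a b <->
  forall x : K, ~ ((map_poly FtoK a).[x] = 0 /\ (map_poly FtoK b).[x] = 0).
Proof.
rewrite -(coprimep_map FtoK); split=> [co x [ax bx]|nr].
  by have := coprimep_root co (introT rootP ax); rewrite bx eqxx.
apply: contraT => /closed_rootP[x]; rewrite root_gcd => /andP[/rootP ax /rootP bx].
by case: (nr x).
Qed.

Lemma pow_p_int (z : int) j : (z%:~R : K) ^+ (p ^ j) = z%:~R.
Proof.
elim: j => [|j IH]; first by rewrite expr1.
rewrite expnSr exprM IH -(pFrobenius_autE (pcharK FtoK p_pr)).
exact: (rmorph_int (pFrobenius_aut (pcharK FtoK p_pr))).
Qed.

Lemma pow_p_inj j : injective (fun x : K => x ^+ (p ^ j)).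
Proof.
move=> x y /=; elim: j => [|j IH]; first by rewrite !expr1.
rewrite expnSr !exprM -!(pFrobenius_autE (pcharK FtoK p_pr)) => /fmorph_inj.
exact: IH.
Qed.

Lemma pow_p_dvd (z : int) j : (p %| z ^+ (p ^ j) - z)%Z.
Proof.
by rewrite -(intrK_eq0 FtoK p_pr) intrB rmorphXn /= pow_p_int subrr.
Qed.

(** * Primes dividing the discriminant and double roots modulo p *)

Section Discriminant.
Variable f : {poly int}.
Hypotheses (mon_f : f \is monic) (size_f : (2 < size f)%N).

Lemma redp_monic : redp p f \is monic. Proof. exact: monic_map. Qed.

Lemma dvd_disc_monic : (p %| disc_monic f)%Z = (p %| resultant f f^`())%Z.
Proof. by rewrite /disc_monic dvdzE abszMsign. Qed.

(** The derivative may lose degree modulo [p], so the integer Sylvester matrix is reduced rather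
    than the resultant. A kernel vector gives u f + w f' = 0 modulo [p]; if f and f' were coprime, f
    would divide the shorter w, so w and then u would vanish. *)
Lemma dvd_resultant_root : (p %| resultant f f^`())%Z ->
  exists b : K, ev b f = 0 /\ ev b f^`() = 0.
Proof.
move=> p_res; suff /negP nco : ~~ coprimep (redp p f) (redp p f^`()).
  have := nco; rewrite -(coprimep_map FtoK) => /negP /closed_rootP[b].
  by rewrite root_gcd !map_redp => /andP[/rootP ? /rootP ?]; exists b.
apply/negP=> co.
have : \det (map_mx (intr : int -> 'F_p) (Sylvester_mx f f^`())) == 0.
  by rewrite det_map_mx /= (intr_eq0_dvdz _ (pchar_Fp p_pr)).
case/det0P=> v' nz_v'.
have [v Dv] : exists v, map_mx (intr : int -> 'F_p) v = v'.
  exists (map_mx (fun x : 'F_p => (x : nat)%:Z) v'); apply/matrixP=> i j.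
  by rewrite !mxE -pmulrn natr_Zp.
rewrite -Dv -map_mxM -[v]hsubmxK mul_row_col !mul_rV_lin1 /=.
set u := rVpoly (lsubmx v); set w := rVpoly (rsubmx v).
have sz_u : (size u <= (size f^`()).-1)%N by apply: size_poly.
have sz_w : (size w <= (size f).-1)%N by apply: size_poly.
have sz_df := size_deriv_int f.
rewrite -linearD => e.
have : redp p (u * f + w * f^`()) = 0.
  apply/polyP=> i; rewrite redpE coef_map coef0 /=.
  have [lti|lei] := ltnP i ((size f^`()).-1 + (size f).-1).
    by have /rowP/(_ (Ordinal lti)) := e; rewrite !mxE.
  rewrite nth_default // (leq_trans _ lei) // (leq_trans (size_polyD _ _)) // geq_max.
  have leU (x y z : nat) : (x <= y.-1 -> 0 < y -> 0 < z -> (x + z).-1 <= y.-1 + z.-1)%N.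
    by lia.
  have df_gt0 : (0 < size f^`())%N by rewrite sz_df; case: (size f) size_f => [|[]].
  have f_gt0 : (0 < size f)%N by case: (size f) size_f.
  apply/andP; split; apply: leq_trans (size_polyMleq _ _) _; first exact: leU.
  by rewrite [leqRHS]addnC; apply: leU.
rewrite redpE rmorphD !rmorphM /= -!redpE => e0.
have w0 : redp p w = 0.
  apply/eqP; apply: contraT => nz_w.
  have : redp p f %| redp p w.
    rewrite -(Gauss_dvdpl _ co).
    by move/eqP: e0; rewrite addrC addr_eq0 => /eqP->; rewrite dvdpNr dvdp_mull.
  move/(dvdp_leq nz_w); rewrite size_map_poly_id0; last first.
    by rewrite (monicP mon_f) oner_eq0.
  rewrite leqNgt (leq_ltn_trans (size_poly _ _)) // (leq_ltn_trans sz_w) //.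
  by case: (size f) size_f.
have u0 : redp p u = 0.
  move/eqP: e0; rewrite w0 mul0r addr0 mulf_eq0 => /orP[/eqP//|].
  by rewrite (negPf (monic_neq0 redp_monic)).
have rV0 m (x : 'rV[int]_m) : redp p (rVpoly x) = 0 -> map_mx (intr : int -> 'F_p) x = 0.
  move=> x0; apply/rowP=> i; rewrite !mxE; have /polyP/(_ i) := x0.
  by rewrite redpE coef_map coef0 /= coef_rVpoly_ord.
case/negP: nz_v'; apply/eqP; rewrite -Dv -(hsubmxK v) map_row_mx.
by rewrite !rV0 // row_mx0.
Qed.

Lemma dvd_disc_root : (p %| disc_monic f)%Z <->
  exists b : K, ev b f = 0 /\ ev b f^`() = 0.
Proof.
rewrite dvd_disc_monic; split; first exact: dvd_resultant_root.
move=> [b [fb dfb]]; have [U [V e]] := resultant_deriv_ideal size_f.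
by rewrite -(intrK_eq0 FtoK p_pr) -(evC b) e !evE fb dfb !mulr0 addr0.
Qed.

End Discriminant.
End PrimeField.

(** * The seven cases *)

(** For nonzero [al] the second equation is b^n = - be / al, and [system_solvable] applies unless
    [be] is 0, which would force b = 0 against b^r = a. This is the source of the two alternatives
    in conditions (ii), (iii) and (iv)(b). *)
Lemma system_linear (K : closedFieldType) (n r : nat) (a al be : K) :
  (0 < n)%N -> (0 < r)%N -> a != 0 ->
  (exists b, b ^+ r = a /\ al * b ^+ n + be = 0) <->
  (al = 0 /\ be = 0) \/
  [/\ al != 0, be != 0 &
     a ^+ (n %/ gcdn n r) * al ^+ (r %/ gcdn n r) = (- be) ^+ (r %/ gcdn n r)].
Proof.
move=> n_gt0 r_gt0 nz_a.
have [al0|nz_al] := eqVneq al 0.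
  split=> [[b [_]]|[[_ be0]|[]//]].
    by rewrite al0 mul0r add0r => be0; left.
  have [|b /rootP] := @closed_rootP _ ('X^r - a%:P) _.
    by rewrite size_XnsubC // eqSS -lt0n.
  rewrite !hornerE => /eqP; rewrite subr_eq0 => /eqP br.
  by exists b; rewrite br al0 be0 mul0r addr0.
pose d := - be / al.
have dE (b : K) : al * b ^+ n + be = 0 <-> b ^+ n = d.
  rewrite /d; split=> [/eqP|->]; last by rewrite mulrC divfK // addNr.
  by rewrite addr_eq0 => /eqP <-; rewrite mulrC mulKf.
have [be0|nz_be] := eqVneq be 0.
  split=> [[b [br /dE]]|[[/eqP]|[]//]]; last by rewrite (negPf nz_al).
  rewrite /d be0 oppr0 mul0r => /eqP; rewrite expf_eq0 => /andP[_ /eqP b0].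
  by move: nz_a; rewrite -br b0 expr0n eqn0Ngt r_gt0 eqxx.
have nz_d : d != 0 by rewrite mulf_neq0 ?invr_eq0 ?oppr_eq0.
have -> : (exists b, b ^+ r = a /\ al * b ^+ n + be = 0) <->
          (exists b, b ^+ n = d /\ b ^+ r = a).
  by split=> -[b [h1 h2]]; exists b; split=> //; apply/dE.
rewrite system_solvable // /d expr_div_n.
have nz_al' : al ^+ (r %/ gcdn n r) != 0 by rewrite expf_neq0.
split=> [e|[[/eqP]|[_ _ <-]]]; last 2 first.
- by rewrite (negPf nz_al).
- by rewrite mulfK.
by right; split; rewrite // -e divfK.
Qed.

Section Cases.
Variables (p : nat) (K : closedFieldType) (FtoK : {rmorphism 'F_p -> K}).
Hypotheses (p_pr : prime p) (FtoK_alg : integralRange FtoK).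
Variables (a c : int) (k m n : nat).
Hypotheses (n_lt : (n < k * m)%N) (n_gt0 : (0 < n)%N).

Local Notation f := (fpoly a c k m n).
Local Notation P := ((p%:Z)%:P : {poly int}).
Local Notation "z %:K" := (z%:~R : K) (at level 2, left associativity, format "z %:K").

Let k_gt0 : (0 < k)%N. Proof. by case: k n_lt. Qed.
Let m_gt0 : (0 < m)%N. Proof. by case: m n_lt; rewrite ?muln0. Qed.

Lemma intK_eq0 z : (p %| z)%Z = (z%:K == 0).
Proof. by rewrite (intrK_eq0 FtoK p_pr). Qed.

Lemma natK_eq0 i : (p %| i)%N = (i%:R == 0 :> K).
Proof. by rewrite pmulrn -intK_eq0. Qed.

Lemma dvdz_sqr z : (p %| z)%Z -> (p%:Z ^+ 2 %| z)%Z = ((divz z p)%:K == 0).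
Proof.
move=> /divzK Dz; rewrite -intK_eq0 -{1}Dz expr2 dvdz_mul2r //.
by case: p p_pr.
Qed.

Lemma polyC_divK z : (p %| z)%Z -> z%:P = P * (divz z p)%:P.
Proof. by move=> /divzK Dz; rewrite -polyCM mulrC Dz. Qed.

Lemma bad_iff1 (g h A B M : {poly int}) (b : K) :
  g = h * h * A + P * h * B + P * M -> ev b h = 0 -> bad p g b <-> ev b M = 0.
Proof.
move=> e h0; apply: (@bad_iff p K FtoK p_pr FtoK_alg g 1 h A B M b) => //.
  by rewrite mul1r; apply: e.
by rewrite ev1 oner_neq0.
Qed.

Lemma evP (b : K) : ev b P = 0. Proof. exact: (evP0 FtoK p_pr). Qed.

Lemma ev_fpoly (b : K) : ev b f = (b ^+ k + c%:K) ^+ m - a%:K * b ^+ n.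
Proof. by rewrite /fpoly !evE. Qed.

Lemma ev_deriv_fpoly (b : K) : ev b f^`() =
  m%:R * k%:R * (b ^+ k + c%:K) ^+ m.-1 * b ^+ k.-1 - a%:K * n%:R * b ^+ n.-1.
Proof.
rewrite /fpoly derivB deriv_exp derivD derivXn derivC addr0 derivM derivC mul0r add0r derivXn.
rewrite evD evN evMn !evM evMn !evXn evD evC !evXn evX evMn evXn evX.
rewrite evC; ring.
Qed.

Definition double_root (b : K) := ev b f = 0 /\ ev b f^`() = 0.

Lemma bad_double (b : K) : bad p f b -> double_root b.
Proof. exact: bad_root. Qed.

Lemma double_root_neq0 (b : K) : ~~ (p %| c)%Z -> double_root b -> b != 0.
Proof.
move=> pc [f0 _]; apply/eqP=> b0; move: f0; rewrite ev_fpoly b0.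
rewrite !expr0n (eqn0Ngt k) (eqn0Ngt n) k_gt0 n_gt0 mulr0 subr0 add0r => /eqP.
by apply/negP; rewrite expf_neq0 // -intK_eq0.
Qed.

(** Take h = X. The constant term c^m is p c2 c^(m - 1), and c2 c^(m - 1) vanishes modulo [p]
    exactly when m > 1 or p^2 divides c. *)
Lemma zero_bad : (p %| c)%Z -> (1 < n)%N || (p %| a)%Z ->
  bad p f (0 : K) <-> ~ (m = 1%N /\ ~~ (p%:Z ^+ 2 %| c)%Z).
Proof.
move=> pc na; have Dc := polyC_divK pc; set c2 := divz c p in Dc.
have [A1 [B1 Dan]] : exists A B, a%:P * 'X^n = 'X * 'X * A + P * 'X * B :> {poly int}.
  case/orP: na => [n2|pa].
    exists (a%:P * 'X^(n.-2)), 0; rewrite -{1}(subnKC n2) exprD expr2.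
    by rewrite -subn2 subn2; ring.
  exists 0, ((divz a p)%:P * 'X^(n.-1)); rewrite polyC_divK // -{1}(prednK n_gt0) exprS.
  by ring.
have [A2 [B2 D2]] : exists A B,
    ('X^k + c%:P) ^+ m = 'X * 'X * A + P * 'X * B + P * (c2 * c ^+ m.-1)%:P :> {poly int}.
  have [A ->] := expD_taylor 'X^k (c%:P) m.
  have -> : (c%:P) ^+ m = P * (c2 * c ^+ m.-1)%:P :> {poly int}.
    by rewrite -{1}(prednK m_gt0) exprS polyCM -rmorphXn /= {1}Dc mulrA.
  have [k1|k2] := leqP 2 k.
    exists (m%:R * c%:P ^+ m.-1 * 'X^(k.-2) + 'X^(k.-1) * 'X^(k.-1) * A), 0.
    by case: k k1 => [|[|k']] // _ /=; rewrite !exprS; ring.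
  (* For k = 1 there is a linear term m c^(m - 1) X, but 1 <= n < m forces m > 1, so its coefficient
     is divisible by [p]. *)
  have [k1 m2] : k = 1%N /\ (1 < m)%N by nia.
  exists A, (m%:R * c2%:P * c%:P ^+ m.-2); rewrite k1 expr1.
  by case: m m2 => [|[|m']] // _ /=; rewrite [c%:P ^+ m'.+1]exprS [X in X * c%:P ^+ m']Dc; ring.
rewrite (@bad_iff1 _ 'X (A2 - A1) (B2 - B1) (c2 * c ^+ m.-1)%:P); first last.
- by rewrite evX.
- by rewrite /fpoly D2 Dan; ring.
rewrite evC dvdz_sqr // -/c2; have c0 : c%:K = 0 by apply/eqP; rewrite -intK_eq0.
rewrite rmorphM rmorphXn /= c0.
have [m1|m2] := leqP m 1.
  have -> : m = 1%N by lia.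
  rewrite expr0 mulr1; split=> [-> [_ /negP[]]//|h].
  by apply/eqP/negPn/negP=> c20; apply: h.
split=> _; first by case=> m1; rewrite m1 in m2.
by case: m m2 => [|[|m']] // _; rewrite exprS mul0r mulr0.
Qed.

(** Modulo [p], f is X^(km), so 0 is the only point to test. *)
Lemma case_i : (p %| c)%Z -> (p %| a)%Z ->
  (forall b : K, ~ bad p f b) <-> (m = 1%N /\ ~~ (p%:Z ^+ 2 %| c)%Z).
Proof.
move=> pc pa; split=> [nb|h b bb].
  have := nb 0; rewrite zero_bad ?pa ?orbT // => nn.
  have [/andP[/eqP m1 c1]|no] := boolP ((m == 1%N) && ~~ (p%:Z ^+ 2 %| c)%Z).
    by [].
  by case: nn => -[m1 c1]; move: no; rewrite m1 c1.
have b0 : b = 0.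
  have [+ _] := bad_double bb; rewrite ev_fpoly.
  have /eqP-> : c%:K == 0 by rewrite -intK_eq0.
  have /eqP-> : a%:K == 0 by rewrite -intK_eq0.
  rewrite addr0 mul0r subr0 => /eqP; rewrite !expf_eq0 => /andP[_ /andP[_ /eqP//]].
by move: bb; rewrite b0 zero_bad ?pa ?orbT.
Qed.

Lemma Xpow_int (z : int) i : (z%:P : {poly int}) ^+ i = (z ^+ i)%:P.
Proof. by rewrite rmorphXn. Qed.

Lemma dvdz_pow_p_sub (z : int) j : (p %| z ^+ (p ^ j) - z)%Z.
Proof. exact: pow_p_dvd FtoK p_pr z j. Qed.

Lemma pow_p_div (z : int) j :
  (z ^+ (p ^ j))%:P = z%:P + P * (divz (z ^+ (p ^ j) - z) p)%:P :> {poly int}.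
Proof. by rewrite -polyC_divK ?dvdz_pow_p_sub // -polyCD addrC subrK. Qed.

Lemma dvdn_pow_p j : (0 < j)%N -> (p %| p ^ j)%N.
Proof. by move=> j0; rewrite -{1}(expn1 p) dvdn_exp2l. Qed.

(** With km - n = p^j s and h = X^s - a, one has X^(km) = X^n (h + a)^(p^j). Modulo (p h, h^2) only
    a^(p^j) = a + p a1 remains of the power, and the expansion in c adds p m c2 X^(k(m - 1)). *)
Lemma nonzero_bad (b : K) j : (p %| c)%Z -> (0 < j)%N -> (p ^ j %| k * m - n)%N ->
  b ^+ (k * m - n) = a%:K ->
  bad p f b <-> (divz (a ^+ (p ^ j) - a) p)%:K * b ^+ n
                + m%:R * (divz c p)%:K * b ^+ (k * m.-1) = 0.
Proof.
move=> pc j_gt0 /dvdnP[s Ds] ba.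
have Dc := polyC_divK pc; set c2 := divz c p in Dc *.
have Da := pow_p_div a j; set a1 := divz _ p in Da *.
pose h : {poly int} := 'X^s - a%:P.
have hb : ev b h = 0.
  rewrite /h !evE; apply/eqP; rewrite subr_eq0; apply/eqP.
  by apply: (pow_p_inj FtoK p_pr (j := j)); rewrite /= -exprM -Ds ba (pow_p_int FtoK p_pr).
have [A1 D1] := expD_taylor c%:P ('X^k : {poly int}) m.
have [A2 [B2 D2]] := expD_taylor_dvd h a%:P (dvdn_pow_p j_gt0).
rewrite (@bad_iff1 _ h ('X^n * A2) ('X^n * B2)
  (a1%:P * 'X^n + m%:R * c2%:P * 'X^(k * m.-1) + P * c2%:P * c2%:P * A1)) //.
  rewrite !evE -/(ev b _) !(intP0 FtoK p_pr) !mul0r addr0.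
  by rewrite mulr1z.
rewrite /fpoly addrC in D1 *; rewrite D1.
have -> : ('X^k : {poly int}) ^+ m = 'X^n * (h + a%:P) ^+ (p ^ j).
  by rewrite /h subrK -!exprM -Ds -exprD subnKC // ltnW.
rewrite D2 Xpow_int Da -exprM [in LHS]Dc; ring.
Qed.

(** Modulo [p], f is X^n (X^(km - n) - a); at such a root b f'(b) equals (km - n) a b^n. *)
Lemma double_c (b : K) : (p %| c)%Z -> double_root b -> b != 0 ->
  b ^+ (k * m - n) = a%:K /\ (p %| k * m - n)%N || (p %| a)%Z.
Proof.
move=> pc [fb dfb] nz_b; have c0 : c%:K = 0 by apply/eqP; rewrite -intK_eq0.
have e : b ^+ (k * m - n) = a%:K.
  apply: (mulIf (expf_neq0 n nz_b)); rewrite -exprD subnK ?(ltnW n_lt) //.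
  apply/eqP; rewrite -subr_eq0; apply/eqP.
  by move: fb; rewrite ev_fpoly c0 addr0 -exprM.
split=> //; rewrite intK_eq0 natK_eq0 natrB ?(ltnW n_lt) // -mulf_eq0 natrM.
apply/eqP/(mulIf (expf_neq0 n nz_b)); rewrite mul0r.
have abn : (b ^+ k) ^+ m = a%:K * b ^+ n.
  by move: fb; rewrite ev_fpoly c0 addr0 => /eqP; rewrite subr_eq0 => /eqP.
transitivity (ev b f^`() * b); last by rewrite dfb mul0r.
rewrite ev_deriv_fpoly c0 addr0.
have E1 : (b ^+ k) ^+ m.-1 * (b ^+ k.-1 * b) = a%:K * b ^+ n.
  by rewrite -exprSr prednK // -exprSr prednK.
have E2 : b ^+ n.-1 * b = b ^+ n by rewrite -exprSr prednK.
transitivity (m%:R * k%:R * ((b ^+ k) ^+ m.-1 * (b ^+ k.-1 * b))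
              - a%:K * n%:R * (b ^+ n.-1 * b)); last by ring.
by rewrite E1 E2; ring.
Qed.

Lemma no_bad_iff_not_exists (g : {poly int}) (Q : K -> Prop) :
  (forall b : K, bad p g b -> Q b) -> (forall b, Q b -> bad p g b) ->
  (forall b : K, ~ bad p g b) <-> ~ exists b, Q b.
Proof.
move=> bQ Qb; split=> [nb [b /Qb]|nQ b /bQ Q_b]; first exact: nb.
by apply: nQ; exists b.
Qed.

Lemma logn_dvd_gt0 x : (0 < x)%N -> (p %| x)%N -> (0 < logn p x)%N.
Proof. by move=> x0 px; rewrite logn_gt0 mem_primes p_pr x0. Qed.

Lemma case_ii : (exists b, double_root b) -> (p %| c)%Z -> ~~ (p %| a)%Z -> n = 1%N ->
  (forall b : K, ~ bad p f b) <->
  (let j := logn p (k * m - 1) in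
   let c2 := divz c p%:Z in
   let a1 := divz (a ^+ (p ^ j) - a) p%:Z in
   ((p%:Z %| c2)%Z && ~~ (p%:Z %| a1)%Z) \/
   ~~ (p%:Z %| c2 * (a ^+ k * a1 ^+ (k * m - 1)
        - (- (m%:Z * a * c2)) ^+ (k * m - 1)))%Z).
Proof.
move=> [b0 db0] pc pa n1 /=.
have nz_a : a%:K != 0 by rewrite -intK_eq0.
have c0 : c%:K = 0 by apply/eqP; rewrite -intK_eq0.
(* As n = 1 and km > 1, the derivative at 0 is - a, a unit modulo [p]. *)
have dbl_neq0 b : double_root b -> b != 0.
  move=> [_ dfb]; apply/eqP=> bz; move: dfb; rewrite ev_deriv_fpoly bz c0 addr0 n1.
  rewrite expr0 !mulr1 -mulrA -exprM -exprD expr0n.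
  have /negPf-> : (k * m.-1 + k.-1 != 0)%N by rewrite -lt0n; nia.
  by rewrite mulr0 sub0r => /eqP; rewrite oppr_eq0 (negPf nz_a).
have pkm : (p %| k * m - 1)%N.
  have [_] := double_c pc db0 (dbl_neq0 _ db0).
  by rewrite n1 (negPf pa) orbF.
have km1_gt0 : (0 < k * m - 1)%N by rewrite subn_gt0 -{1}n1.
set j := logn p (k * m - 1).
have j_gt0 : (0 < j)%N by apply: logn_dvd_gt0.
have pj : (p ^ j %| k * m - n)%N by rewrite n1 pfactor_dvdnn.
set c2 := divz c _; set a1 := divz _ _.
(* Multiplying the criterion by b^k and using b^(km) = a b gives an equation linear in b^k, the
   shape treated by [system_linear]. *)
pose Q (b : K) := b ^+ (k * m - 1) = a%:K /\ a1%:K * b ^+ k + m%:R * a%:K * c2%:K = 0.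
have badQ b : b ^+ (k * m - n) = a%:K -> bad p f b <-> Q b.
  move=> ba; rewrite (nonzero_bad pc j_gt0 pj ba) -/a1 -/c2 /Q.
  have nz_b : b != 0.
    apply: contraNneq nz_a => bz; rewrite -ba bz n1 expr0n.
    by rewrite eqn0Ngt km1_gt0.
  have e : a1%:K * b ^+ n + m%:R * c2%:K * b ^+ (k * m.-1) =
      (a1%:K * b ^+ k + m%:R * a%:K * c2%:K) * b / b ^+ k.
    have E : b ^+ (k * m.-1) * b ^+ k = a%:K * b.
      rewrite -exprD -mulnSr prednK // -{1}(subnK (ltnW n_lt)) exprD ba.
      by rewrite n1 expr1.
    apply: (mulIf (expf_neq0 k nz_b)); rewrite divfK ?expf_neq0 // n1 expr1.
    transitivity (a1%:K * b * b ^+ k + m%:R * c2%:K * (b ^+ (k * m.-1) * b ^+ k)).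
      by ring.
    by rewrite E; ring.
  rewrite e; split=> [/eqP|[_ ->]]; last by rewrite !mul0r.
  rewrite !mulf_eq0 invr_eq0 expf_eq0 (negPf nz_b) andbF !orbF => /eqP.
  by split=> //; rewrite -ba n1.
rewrite (@no_bad_iff_not_exists f Q); first last.
- by move=> b Qb; apply/badQ => //; rewrite n1; case: Qb.
- move=> b bb; apply/badQ => //.
  by have [] := double_c pc (bad_double bb) (dbl_neq0 _ (bad_double bb)).
have g1 : gcdn k (k * m - 1) = 1%N.
  apply/eqP; rewrite -dvdn1 -[X in (_ %| X)%N](subKn (m := 1) (n := k * m)); last by lia.
  by rewrite dvdn_sub ?dvdn_gcdr // dvdn_mulr // dvdn_gcdl.
have := @system_linear K k (k * m - 1) a%:K a1%:K (m%:R * a%:K * c2%:K) k_gt0 km1_gt0 nz_a.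
rewrite g1 !divn1 -/(Q _) => ->.
have nz_m : m%:R != 0 :> K.
  rewrite -natK_eq0; apply/negP=> pm; have : (p %| 1)%N.
    by rewrite -(dvdn_addr 1 pkm) subnK ?dvdn_mull // muln_gt0 k_gt0.
  by rewrite dvdn1 => /eqP p1; move: p_pr; rewrite p1.
rewrite !intK_eq0 rmorphM rmorphB rmorphM !rmorphXn rmorphN !rmorphM /= (mulf_eq0 c2%:K) subr_eq0.
have -> : (m%:R * a%:K * c2%:K == 0) = (c2%:K == 0) by rewrite !mulf_eq0 (negPf nz_m) (negPf nz_a).
rewrite -pmulrn.
have [c20|nz_c2] /= := eqVneq c2%:K 0.
  rewrite c20 mulr0; have [a10|nz_a1] /= := eqVneq a1%:K 0.
    by split=> [[]|[]//]; left.
  split=> _; first by left.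
  by case=> [[a10]|[]//]; move: nz_a1; rewrite a10 eqxx.
have [a10|nz_a1] /= := eqVneq a1%:K 0.
  split=> _; last first.
    by case=> [[_ /eqP]|[]//]; rewrite !mulf_eq0 (negPf nz_m) (negPf nz_a) (negPf nz_c2).
  right; rewrite a10 expr0n eqn0Ngt km1_gt0 mulr0 eq_sym expf_eq0 oppr_eq0 !mulf_eq0.
  by rewrite (negPf nz_m) (negPf nz_a) (negPf nz_c2) andbF.
split=> [h|[//|/eqP ne]].
  by right; apply/negP=> /eqP e; apply: h; right; split.
case=> [[a10]|[_ _ e]]; last exact: ne.
by move: nz_a1; rewrite a10 eqxx.
Qed.

Lemma case_iii : (p %| c)%Z -> ~~ (p %| a)%Z -> (2 <= n)%N ->
  (forall b : K, ~ bad p f b) <->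
  (m = 1%N /\
   (let l := logn p (k - n) in
    let c2 := divz c p%:Z in
    let a1 := divz (a ^+ (p ^ l) - a) p%:Z in
    ((p%:Z %| a1)%Z && ~~ (p%:Z %| c2)%Z) \/
    ~~ (p%:Z %| a1 * c2 ^+ (n - 1) *
       (a ^+ (n %/ gcdn n k) * a1 ^+ (k %/ gcdn n k - n %/ gcdn n k)
        - (- c2) ^+ (k %/ gcdn n k - n %/ gcdn n k)))%Z)).
Proof.
move=> pc pa n2 /=.
have nz_a : a%:K != 0 by rewrite -intK_eq0.
set c2 := divz c _; set a1 := divz _ _.
have nc2 : (p%:Z ^+ 2 %| c)%Z = (c2%:K == 0) by rewrite dvdz_sqr.
have n21 : (n - 1 != 0)%N by rewrite subn_eq0 -ltnNge.
(* The point 0 is bad unless m = 1 and c2 is a unit modulo [p]; the stated condition fails as well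
   when c2 vanishes, because n - 1 > 0. *)
have [/andP[/eqP m1 nz_c2]|no] := boolP ((m == 1%N) && (c2%:K != 0)); last first.
  split=> [nb|[m1 h]].
    have := nb 0; rewrite zero_bad ?n2 // nc2 => -[] [m1 nz].
    by move: no; rewrite m1 nz.
  move: no; rewrite m1 /= negbK => c20; exfalso; move: h.
  rewrite !intK_eq0 c20 andbF !rmorphM rmorphXn /= (eqP c20) expr0n (negPf n21).
  by rewrite mulr0 mul0r eqxx; case.
have n_lt_k : (n < k)%N by move: n_lt; rewrite m1 muln1.
have k1n1 : (k %/ gcdn n k - n %/ gcdn n k = (k - n) %/ gcdn n k)%N.
  by rewrite divnBr ?dvdn_gcdl.
have Dg : gcdn n k = gcdn n (k - n) by rewrite -{1}(subnK (ltnW n_lt_k)) gcdnDr.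
have nz0 : ~ bad p f (0 : K) by rewrite zero_bad ?n2 // nc2; case.
(* If [p] does not divide k - n, there is no nonzero double root, while the exponent [l] is 0, so a1
   = 0 and the first alternative holds. *)
have [pkn|pkn] := boolP (p %| k - n)%N; last first.
  have a10 : a1 = 0.
    by rewrite /a1 lognE p_pr (negPf pkn) andbF expn0 expr1 subrr div0z.
  split=> [_|_ b bb].
    by split=> //; left; rewrite !intK_eq0 a10 eqxx.
  have [b0|nz_b] := eqVneq b 0; first by apply: nz0; rewrite -b0.
  have [_] := double_c pc (bad_double bb) nz_b.
  by rewrite m1 muln1 (negPf pkn) (negPf pa).
have kn_gt0 : (0 < k - n)%N by rewrite subn_gt0.
have l_gt0 := logn_dvd_gt0 kn_gt0 pkn.
pose Q (b : K) := b ^+ (k - n) = a%:K /\ a1%:K * b ^+ n + c2%:K = 0.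
have badQ b : b ^+ (k - n) = a%:K -> bad p f b <-> a1%:K * b ^+ n + c2%:K = 0.
  move=> ba; have pl : (p ^ logn p (k - n) %| k * m - n)%N by rewrite m1 muln1 pfactor_dvdnn.
  rewrite (@nonzero_bad b _ pc l_gt0 pl) -/a1 -/c2; last by rewrite m1 muln1.
  by rewrite m1 muln0 expr0 mul1r mulr1.
rewrite (@no_bad_iff_not_exists f Q); first last.
- by move=> b [ba h]; apply/badQ.
- move=> b bb; have nz_b : b != 0 by apply/eqP=> b0; apply: nz0; rewrite -b0.
  have [+ _] := double_c pc (bad_double bb) nz_b; rewrite m1 muln1 => ba.
  by split=> //; apply/badQ.
rewrite (@system_linear K n (k - n) a%:K a1%:K c2%:K n_gt0 kn_gt0 nz_a) -Dg -k1n1.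
rewrite !intK_eq0 !rmorphM rmorphB rmorphM !rmorphXn rmorphN /=.
set k' := (_ - _)%N; set n' := (n %/ _)%N.
have k'_gt0 : (0 < k')%N.
  by rewrite /k' k1n1 divn_gt0 ?gcdn_gt0 ?n_gt0 // Dg dvdn_leq // dvdn_gcdr.
rewrite !(mulf_eq0 _ (_ - _)) subr_eq0 [_ * c2%:K ^+ _ == 0]mulf_eq0 expf_eq0 (negPf nz_c2) andbF orbF.
have [a10|nz_a1] /= := eqVneq a1%:K 0.
  by split=> [_|_]; [split=> //; left|case=> [[_ /eqP]|[]//]; rewrite (negPf nz_c2)].
split=> [h|[_ [//|/eqP ne]]].
  by split=> //; right; apply/negP=> /eqP e; apply: h; right; split.
case=> [[a10]|[_ _ e]]; last exact: ne.
by move: nz_a1; rewrite a10 eqxx.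
Qed.

(** Take h = X^k + c, whose square divides (X^k + c)^m. The remainder - a2 X^n vanishes at all
    double roots or at none, since these are nonzero. *)
Lemma case_iv_ge2 : (exists b, double_root b) -> ~~ (p %| c)%Z -> (p %| a)%Z -> (2 <= m)%N ->
  (forall b : K, ~ bad p f b) <-> ~~ (p%:Z ^+ 2 %| a)%Z.
Proof.
move=> [b0 db0] pc pa m2; have a0 : a%:K = 0 by apply/eqP; rewrite -intK_eq0.
have Da := polyC_divK pa; rewrite dvdz_sqr //; set a2 := divz a p in Da *.
have badE b : double_root b -> bad p f b <-> a2%:K = 0.
  move=> db; have nz_b := double_root_neq0 pc db.
  rewrite (@bad_iff1 _ ('X^k + c%:P) (('X^k + c%:P) ^+ m.-2) 0 (- (a2%:P * 'X^n))); first last.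
  - have [/eqP + _] := db; rewrite ev_fpoly a0 mul0r subr0 expf_eq0 => /andP[_ /eqP].
    by rewrite !evE.
  - by rewrite /fpoly Da; case: m m2 => [|[|m']] // _ /=; rewrite !exprS; ring.
  rewrite !evE; split=> [/eqP|->]; last by rewrite mul0r oppr0.
  by rewrite oppr_eq0 mulf_eq0 expf_eq0 (negPf nz_b) andbF orbF => /eqP.
split=> [nb|/eqP nz b bb]; first by apply/eqP=> a20; apply: (nb b0); apply/badE.
by apply: nz; apply: (badE b (bad_double bb)).1.
Qed.

(** Modulo [p], f is X^k + c, and a double root forces p to divide k. With k = s p^l and h = X^s +
    c, expanding X^k = (h - c)^(p^l) leaves the remainder c1 + a2 X^n. *)
Lemma case_iv_1 : (exists b, double_root b) -> ~~ (p %| c)%Z -> (p %| a)%Z -> m = 1%N ->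
  (forall b : K, ~ bad p f b) <->
  (let l := logn p k in
   let a2 := divz (- a) p%:Z in
   let c1 := divz ((- c) ^+ (p ^ l) + c) p%:Z in
   ((p%:Z %| a2)%Z && ~~ (p%:Z %| c1)%Z) \/
   ~~ (p%:Z %| a2 * (a2 ^+ (k %/ gcdn n k) * (- c) ^+ (n %/ gcdn n k)
                     - (- c1) ^+ (k %/ gcdn n k)))%Z).
Proof.
move=> [b0 db0] pc pa m1 /=; have a0 : a%:K = 0 by apply/eqP; rewrite -intK_eq0.
have nz_c : - c%:K != 0 by rewrite oppr_eq0 -intK_eq0.
have bc b : double_root b -> b ^+ k = - c%:K.
  move=> [+ _]; rewrite ev_fpoly a0 mul0r subr0 m1 expr1 => /eqP.
  by rewrite addr_eq0 => /eqP.
have pk : (p %| k)%N.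
  have [_ +] := db0; rewrite ev_deriv_fpoly a0 mul0r mul0r subr0 m1 expr0 !mulr1 mul1r => /eqP.
  rewrite mulf_eq0 expf_eq0 natK_eq0 => /orP[//|/andP[_ /eqP bz]].
  by have := double_root_neq0 pc db0; rewrite bz eqxx.
set l := logn p k; have l_gt0 : (0 < l)%N by apply: logn_dvd_gt0.
set a2 := divz _ _; set c1 := divz _ _.
have pna : (p %| - a)%Z by rewrite intK_eq0 intrN a0 oppr0.
have Da : a%:P = - (P * a2%:P) by rewrite -(polyC_divK pna) -polyCN opprK.
have Dc : ((- c) ^+ (p ^ l))%:P = - c%:P + P * c1%:P :> {poly int}.
  by have := pow_p_div (- c) l; rewrite opprK polyCN.
have [s Ds] : exists s, k = (s * p ^ l)%N by apply/dvdnP; rewrite pfactor_dvdnn.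
pose h : {poly int} := 'X^s + c%:P.
have [A [B D]] := expD_taylor_dvd h (- c)%:P (dvdn_pow_p l_gt0).
pose Q (b : K) := b ^+ k = - c%:K /\ a2%:K * b ^+ n + c1%:K = 0.
have badQ b : b ^+ k = - c%:K -> bad p f b <-> a2%:K * b ^+ n + c1%:K = 0.
  move=> bk; rewrite (@bad_iff1 _ h A B (c1%:P + a2%:P * 'X^n)).
  - by rewrite !evE addrC.
  - rewrite /fpoly m1 expr1 Ds exprM.
    have -> : 'X^s = h + (- c)%:P by rewrite /h polyCN addrK.
    by rewrite D Xpow_int Dc Da; ring.
  rewrite /h !evE; apply/eqP; rewrite addr_eq0 -intrN; apply/eqP.
  by apply: (pow_p_inj FtoK p_pr (j := l)); rewrite /= -exprM -Ds bk (pow_p_int FtoK p_pr) intrN.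
rewrite (@no_bad_iff_not_exists f Q); first last.
- by move=> b [ba h']; apply/badQ.
- by move=> b bb; have bk := bc _ (bad_double bb); split=> //; apply/badQ.
rewrite (@system_linear K n k (- c%:K) a2%:K c1%:K n_gt0 k_gt0 nz_c).
rewrite !intK_eq0 !rmorphM rmorphB rmorphM !rmorphXn !rmorphN /=.
set k' := (k %/ _)%N; set n' := (n %/ _)%N.
have k'_gt0 : (0 < k')%N.
  by rewrite /k' divn_gt0 ?gcdn_gt0 ?n_gt0 // dvdn_leq // dvdn_gcdr.
rewrite (mulf_eq0 a2%:K) subr_eq0.
have [a20|nz_a2] /= := eqVneq a2%:K 0.
  split=> [h0|[nz|//]]; last by case=> [[_ c10]|[]//]; move: nz; rewrite c10 eqxx.
  by left; apply/negP=> /eqP c10; apply: h0; left.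
split=> [h0|[//|/eqP ne]]; last first.
  case=> [[a20]|[_ _ e]]; last by apply: ne; rewrite mulrC.
  by move: nz_a2; rewrite a20 eqxx.
right; apply/negP=> /eqP e; have [c10|nz_c1] := eqVneq c1%:K 0.
  move/eqP: e; rewrite c10 oppr0 expr0n (eqn0Ngt k') k'_gt0 mulf_eq0 !expf_eq0.
  by rewrite (negPf nz_a2) (negPf nz_c) !andbF.
by apply: h0; right; split; rewrite // mulrC.
Qed.

Lemma binomial_split q s' : ('X^s' + c%:P) ^+ q =
  \sum_(i < q) (('C(q, i))%:R * c ^+ (q - i))%:P * 'X^(s' * i) + 'X^(s' * q) :> {poly int}.
Proof.
rewrite addrC exprDn big_ord_recr /= subnn expr0 mul1r binn mulr1n -exprM.
congr (_ + _); apply: eq_bigr => i _.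
by rewrite -exprM Xpow_int -mulrnAl -polyCMn mulr_natl.
Qed.

(** The coefficientwise division in [tpoly] is exact: modulo [p] the sum is (X^s' + c)^(p^j) - X^(s'
    p^j) - c = c^(p^j) - c = 0. *)
Lemma tpoly_divK j s' : P * tpoly p j s' c =
  \sum_(i < p ^ j) (('C(p ^ j, i))%:R * c ^+ (p ^ j - i))%:P * 'X^(s' * i) - c%:P.
Proof.
set G : {poly int} := \sum_(i < _) _.
have DG : ('X^s' + c%:P) ^+ (p ^ j) = G + 'X^(s' * p ^ j).
  exact: binomial_split.
apply/polyP=> i; rewrite coefCM coef_map_id0 ?div0z // mulrC divzK // intK_eq0.
have /polyP/(_ i) : map_poly intr (G - c%:P) = 0 :> {poly K}.
  have -> : G = ('X^s' + c%:P) ^+ (p ^ j) - 'X^(s' * p ^ j) by rewrite DG addrK.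
  rewrite !rmorphB /= rmorphXn rmorphD /= !map_polyXn map_polyC /=.
  rewrite GRing.exprDn_pchar.
    by rewrite -exprM -rmorphXn /= (pow_p_int FtoK p_pr); ring.
  by rewrite pnatX pnatE // pchar_poly (pcharK FtoK p_pr).
by rewrite coef_map coef0 /= => ->.
Qed.

Lemma double_noc (b : K) : ~~ (p %| c)%Z -> ~~ (p %| a)%Z -> (p %| k * m)%N ->
  double_root b -> (p %| n)%N.
Proof.
move=> pc pa pkm db; have [_] := db; rewrite ev_deriv_fpoly.
have /eqP : (k * m)%:R == 0 :> K by rewrite -natK_eq0.
rewrite natrM => km0; rewrite [m%:R * _]mulrC km0 !mul0r sub0r => /eqP.
have nz_b := double_root_neq0 pc db.
rewrite oppr_eq0 !mulf_eq0 expf_eq0 (negPf nz_b) andbF orbF.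
by rewrite -intK_eq0 (negPf pa) -natK_eq0.
Qed.

(** Modulo [p], f is the p^j-th power of h = (X^s' + c)^m - a X^s. Expanding both in h and in p t(x)
    leaves [M0], up to a multiple of [p]; coprimality says that h and [M0] have no common root. *)
Lemma case_v : (exists b, double_root b) -> ~~ (p %| c)%Z -> ~~ (p %| a)%Z -> (p %| k)%N ->
  (forall b : K, ~ bad p f b) <->
  (let j := minn (logn p k) (logn p n) in
   let s' := (k %/ p ^ j)%N in
   let s := (n %/ p ^ j)%N in
   let a1 := divz (a ^+ (p ^ j) - a) p%:Z in
   let tt := tpoly p j s' c in
   coprimep
     (redp p (a1%:P * 'X^n - (m%:Z)%:P * tt * ('X^k + c%:P) ^+ (m - 1)))
     (redp p (('X^s' + c%:P) ^+ m - a%:P * 'X^s))).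
Proof.
move=> [b0 db0] pc pa pk /=.
have pn : (p %| n)%N by apply: double_noc db0 => //; apply: dvdn_mulr.
set j := minn _ _.
have j_gt0 : (0 < j)%N by rewrite leq_min !logn_dvd_gt0.
have Dk : k = (k %/ p ^ j * p ^ j)%N.
  by rewrite divnK // pfactor_dvdn // geq_minl.
have Dn : n = (n %/ p ^ j * p ^ j)%N.
  by rewrite divnK // pfactor_dvdn // geq_minr.
set s' := (k %/ _)%N in Dk *; set s := (n %/ _)%N in Dn *.
set a1 := divz _ _; set tt := tpoly _ _ _ _.
pose u : {poly int} := 'X^s' + c%:P; pose w : {poly int} := 'X^k + c%:P.
pose h := u ^+ m - a%:P * 'X^s.
pose M0 := a1%:P * 'X^n - (m%:Z)%:P * tt * w ^+ (m - 1).
have Du : u ^+ (p ^ j) = P * tt + w.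
  by rewrite tpoly_divK /w /u binomial_split -Dk addrACA addNr addr0.
have [A1 D1] := expD_taylor (P * tt) w m.
have [A2 [B2 D2]] := expD_taylor_dvd h (a%:P * 'X^s) (dvdn_pow_p j_gt0).
have badM (b : K) : ev b h = 0 -> bad p f b <-> ev b M0 = 0.
  move=> hb; rewrite (@bad_iff1 _ h A2 B2 (M0 - P * tt * tt * A1)) //.
    by rewrite evD evN !evM evP !mul0r subr0.
  rewrite /fpoly -/w.
  have -> : w ^+ m = (u ^+ m) ^+ (p ^ j) - m%:R * w ^+ m.-1 * (P * tt) - P * tt * (P * tt) * A1.
    by rewrite -exprM mulnC exprM Du D1; ring.
  have -> : u ^+ m = h + a%:P * 'X^s by rewrite /h subrK.
  rewrite D2 exprMn Xpow_int -exprM -Dn (pow_p_div a j) -/a1 /M0 subn1.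
  by rewrite -[m%:Z]natz rmorph_nat; ring.
have hf (b : K) : ev b f = 0 -> ev b h = 0.
  rewrite ev_fpoly /h !evE => /eqP; rewrite subr_eq0 => /eqP e; apply/eqP.
  rewrite subr_eq0; apply/eqP/(pow_p_inj FtoK p_pr (j := j)) => /=.
  rewrite exprMn (pow_p_int FtoK p_pr) -[(b ^+ s) ^+ _]exprM -Dn -e exprAC; congr (_ ^+ m).
  rewrite GRing.exprDn_pchar -?exprM -?Dk ?(pow_p_int FtoK p_pr) //.
  by rewrite pnatX pnatE // (pcharK FtoK p_pr).
rewrite -/u -/w -/h -/M0 (coprimep_closure FtoK) !map_redp.
split=> [nb x [Mx hx]|nb b bb]; first exact: (nb x ((badM x hx).2 Mx)).
have hb := hf b (bad_double bb).1.
by apply: (nb b); split=> //; apply/badM.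
Qed.

(** A double root forces p to divide n, so f is a p-th power modulo [p], and the expansion in its
    p-th root [h] leaves a1 X^n, nonzero at [b] exactly when a1 is. *)
Lemma case_vi : (exists b, double_root b) -> ~~ (p %| c)%Z -> ~~ (p %| a)%Z -> (p %| m)%N ->
  (forall b : K, ~ bad p f b) <-> ((p %| n)%N /\ ~~ (p%:Z ^+ 2 %| a ^+ p - a)%Z).
Proof.
move=> [b0 db0] pc pa pm.
have pn : (p %| n)%N by apply: double_noc db0 => //; apply: dvdn_mull.
have Da := pow_p_div a 1; have pa1 := dvdz_pow_p_sub a 1; rewrite expn1 in Da pa1.
rewrite dvdz_sqr //; set a1 := divz _ _ in Da *.
have [m' Dm] := dvdnP pm; have [n' Dn] := dvdnP pn.
pose h : {poly int} := ('X^k + c%:P) ^+ m' - a%:P * 'X^n'.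
have [A2 [B2 D2]] := expD_taylor_dvd h (a%:P * 'X^n') (dvdnn p).
have badE b : double_root b -> bad p f b <-> a1%:K = 0.
  move=> db; have nz_b := double_root_neq0 pc db.
  rewrite (@bad_iff1 _ h A2 B2 (a1%:P * 'X^n)); first last.
  - have [/eqP + _] := db; rewrite ev_fpoly subr_eq0 => /eqP e.
    rewrite /h !evE; apply/eqP; rewrite subr_eq0; apply/eqP/(pow_p_inj FtoK p_pr (j := 1)) => /=.
    rewrite exprMn (pow_p_int FtoK p_pr) expn1 -!exprM -Dn -Dm; exact: e.
  - rewrite /fpoly Dm exprM; have -> : ('X^k + c%:P) ^+ m' = h + a%:P * 'X^n' by rewrite /h subrK.
    by rewrite D2 exprMn Xpow_int -exprM -Dn Da; ring.
  rewrite !evE; split=> [/eqP|->]; last by rewrite mul0r.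
  by rewrite mulf_eq0 expf_eq0 (negPf nz_b) andbF orbF => /eqP.
split=> [nb|[_ /eqP nz] b bb]; last by apply: nz; apply: (badE b (bad_double bb)).1.
by split=> //; apply/eqP=> a10; apply: (nb b0); apply/badE.
Qed.

Lemma case_vii : (exists b, double_root b) ->
  ~~ (p %| c)%Z -> ~~ (p %| a)%Z -> ~~ (p %| k)%N -> ~~ (p %| m)%N ->
  (forall b : K, ~ bad p f b) <->
  (let n1 := (n %/ gcdn n k)%N in let k1 := (k %/ gcdn n k)%N in
   let CC := ((k * m)%:Z) ^+ (k1 * m) * c ^+ (k1 * m - n1) in
   let EE := a ^+ k1 * (n%:Z) ^+ n1 * ((k * m - n)%:Z) ^+ (k1 * m - n1) in
   ~~ (p%:Z ^+ 2 %| CC - EE)%Z).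
Proof.
move=> [b0 db0] pc pa pk pm /=.
have nz_a : a%:K != 0 by rewrite -intK_eq0.
have nz_c : c%:K != 0 by rewrite -intK_eq0.
have nz_k : k%:R != 0 :> K by rewrite -natK_eq0.
have nz_m : m%:R != 0 :> K by rewrite -natK_eq0.
set t := gcdn n k; have t_gt0 : (0 < t)%N by rewrite gcdn_gt0 n_gt0.
have := divnK (dvdn_gcdl n k); have := divnK (dvdn_gcdr n k); rewrite -/t.
move: (n %/ t)%N (k %/ t)%N => n1 k1 Dk Dn.
have nz_t : t%:R != 0 :> K.
  by apply: contraNneq nz_k => t0; rewrite -Dk natrM t0 mulr0.
have nz_k1 : k1%:R != 0 :> K.
  by apply: contraNneq nz_k => k10; rewrite -Dk natrM k10 mul0r.
have k1_gt0 : (0 < k1)%N by case: k1 Dk {nz_k1} => // k0; move: k_gt0; rewrite -k0.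
have n1_gt0 : (0 < n1)%N by case: n1 Dn => // n0; move: n_gt0; rewrite -n0.
have n1_lt : (n1 < k1 * m)%N.
  by rewrite -(ltn_pmul2r t_gt0) Dn mulnAC Dk.
set D := (k * m - n)%N.
have DD : (k * m)%:Z = D%:Z + n%:Z by rewrite -PoszD subnK // ltnW.
have DDK : k%:R * m%:R = D%:R + n%:R :> K by rewrite -natrM -natrD subnK // ltnW.
set CC := _ * _; set EE := _ * _.
pose kmc : int := (k * m)%:Z * c; pose nc : int := n%:Z * c.
pose h : {poly int} := (D%:Z)%:P * 'X^k - nc%:P.
pose V := (h + kmc%:P) ^+ m; pose w : {poly int} := (a * D%:Z ^+ m)%:P * 'X^n.
have DV : V = (D%:Z)%:P ^+ m * ('X^k + c%:P) ^+ m.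
  rewrite /V /h -exprMn; congr (_ ^+ m); rewrite mulrDr -polyCM -addrA; congr (_ + _).
  by rewrite -polyCN -polyCD /kmc /nc DD; congr (_%:P); ring.
have DVw : (D%:Z)%:P ^+ m * f = V - w.
  by rewrite DV /w /fpoly polyCM Xpow_int; ring.
(* [V] is a polynomial in X^k, hence in [h], but [w] is not; its k1-th power is one because n k1 = k
   n1. [S] is the cofactor of [f] in the difference of k1-th powers. *)
pose S' := \sum_(i < k1) V ^+ (k1.-1 - i) * w ^+ i.
pose S := (D%:Z)%:P ^+ m * S'.
have DS : S * f = V ^+ k1 - w ^+ k1.
  by rewrite subrXX -/S' -DVw /S; ring.
have [A1 D1] := expD_taylor h kmc%:P (m * k1).
have [A2 D2] := expD_taylor h nc%:P n1.
(* [c0] and [L] are the coefficients of degree 0 and 1 of [S * f] in [h]. They are proportional by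
   [Lc0], with t c prime to [p], so they vanish together modulo [p]. *)
pose c0 : int := kmc ^+ (m * k1) - a ^+ k1 * D%:Z ^+ (m * k1 - n1) * nc ^+ n1.
pose L : int := (m * k1)%:Z * kmc ^+ (m * k1).-1
  - a ^+ k1 * D%:Z ^+ (m * k1 - n1) * (n1%:Z * nc ^+ n1.-1).
have m_lt : (n1 < m * k1)%N by rewrite mulnC.
have Lc0 : t%:Z * c * L = c0.
  have E1 : kmc ^+ (m * k1) = kmc * kmc ^+ (m * k1).-1.
    by rewrite -exprS prednK // (leq_trans _ m_lt).
  have E2 : nc ^+ n1 = nc * nc ^+ n1.-1 by rewrite -exprS prednK.
  have E3 : kmc = k1%:Z * t%:Z * m%:Z * c by rewrite /kmc -Dk !PoszM.
  have E4 : nc = n1%:Z * t%:Z * c by rewrite /nc -Dn PoszM.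
  rewrite /L /c0 E1 E2 PoszM; move: (kmc ^+ _.-1) (nc ^+ _.-1) => X Y.
  by rewrite E3 E4; ring.
have c0E : c0 = c ^+ n1 * (CC - EE).
  rewrite /c0 /CC /EE /kmc /nc !exprMn mulrBr [(m * k1)%N]mulnC; congr (_ - _); last by ring.
  by rewrite -{2}(subnKC (ltnW n1_lt)) exprD; ring.
pose a' := a ^+ k1 * D%:Z ^+ (m * k1 - n1).
have DSh : S * f = h * h * (A1 - a'%:P * A2) + h * L%:P + c0%:P.
  have natC i : i%:R = (i%:Z)%:P :> {poly int} by rewrite -(rmorph_nat polyC i) natz.
  have Vk : V ^+ k1 = (h + kmc%:P) ^+ (m * k1) by rewrite exprM.
  have wk : w ^+ k1 = a'%:P * (h + nc%:P) ^+ n1.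
    have Enk : (n * k1 = k * n1)%N by rewrite -Dn -Dk mulnAC [RHS]mulnAC (mulnC n1).
    rewrite /w exprMn Xpow_int -exprM Enk /h subrK [in RHS]exprMn -['X^k ^+ n1]exprM Xpow_int mulrA -polyCM.
    congr (_%:P * _).
    by rewrite /a' exprMn -exprM -{1}(subnK (ltnW m_lt)) exprD mulrA.
  rewrite DS Vk wk D1 D2 !natC !Xpow_int /L /c0 -/a' !(polyCD, polyCN, polyCM); ring.
have key (b : K) : double_root b -> ev b h = 0 /\ ev b S != 0.
  move=> db; have [fb dfb] := db; have nz_b := double_root_neq0 pc db.
  have e1 : (b ^+ k + c%:K) ^+ m = a%:K * b ^+ n.
    by apply/eqP; rewrite -subr_eq0 -ev_fpoly fb.
  have nz_bn : a%:K * b ^+ n != 0 by rewrite mulf_neq0 ?expf_neq0.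
  have nz_bc : b ^+ k + c%:K != 0.
    by apply: contraNneq nz_bn => bc0; rewrite -e1 bc0 expr0n (eqn0Ngt m) m_gt0.
  (* From b f'(b) = 0, replacing a b^n by (b^k + c)^m and cancelling (b^k + c)^(m - 1). *)
  have e2 : D%:R * b ^+ k = n%:R * c%:K.
    have E1 : b ^+ k.-1 * b = b ^+ k by rewrite -exprSr prednK.
    have E2 : b ^+ n.-1 * b = b ^+ n by rewrite -exprSr prednK.
    have E3 : (b ^+ k + c%:K) ^+ m.-1 * (b ^+ k + c%:K) = (b ^+ k + c%:K) ^+ m.
      by rewrite -exprSr prednK.
    have : ev b f^`() * b = 0 by rewrite dfb mul0r.
    rewrite ev_deriv_fpoly.
    have -> : (m%:R * k%:R * (b ^+ k + c%:K) ^+ m.-1 * b ^+ k.-1 - a%:K * n%:R * b ^+ n.-1) * b =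
      k%:R * m%:R * (b ^+ k + c%:K) ^+ m.-1 * (b ^+ k.-1 * b) - n%:R * (a%:K * (b ^+ n.-1 * b)) by ring.
    rewrite E1 E2 -e1 -E3 DDK.
    have -> : (D%:R + n%:R) * (b ^+ k + c%:K) ^+ m.-1 * b ^+ k
        - n%:R * ((b ^+ k + c%:K) ^+ m.-1 * (b ^+ k + c%:K)) =
        (b ^+ k + c%:K) ^+ m.-1 * (D%:R * b ^+ k - n%:R * c%:K) by ring.
    move/eqP; rewrite mulf_eq0 expf_eq0 (negPf nz_bc) andbF /= subr_eq0.
    by move/eqP.
  have nz_n : n%:R != 0 :> K.
    apply/eqP=> n0; have : k%:R * m%:R * b ^+ k = 0 by rewrite DDK mulrDl e2 n0; ring.
    by apply/eqP; rewrite !mulf_neq0 ?expf_neq0.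
  have nz_D : D%:R != 0 :> K.
    apply/eqP=> D0; have : n%:R * c%:K = 0 by rewrite -e2 D0 mul0r.
    by apply/eqP; rewrite mulf_neq0.
  have hb : ev b h = 0.
    by rewrite /h !evE /nc intrM -!pmulrn e2 subrr.
  split=> //; have Vb : ev b V = ev b w.
    by apply/eqP; rewrite -subr_eq0 -evN -evD -DVw evM fb mulr0.
  have nz_w : ev b w != 0.
    by rewrite /w !evE rmorphM rmorphXn /= -pmulrn !mulf_neq0 ?expf_neq0.
  (* Since V(b) = w(b), the k1 terms of the geometric sum coincide, and [p] does not divide k1. *)
  have S'b : ev b S' = k1%:R * ev b w ^+ k1.-1.
    rewrite /S' /ev rmorph_sum horner_sum -/(ev b).
    under eq_bigr => i _.
      rewrite -/(ev b _) evM (evXn _ V) (evXn _ w) Vb -exprD subnK; last by rewrite -ltnS prednK.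
      over.
    by rewrite sumr_const card_ord mulr_natl.
  by rewrite /S !evE S'b -pmulrn !mulf_neq0 ?expf_neq0.
have c00 : c0%:K = 0.
  have [hb _] := key b0 db0.
  have : ev b0 (S * f) = 0 by rewrite evM db0.1 mulr0.
  have evh X : ev b0 (h * X) = 0 by rewrite evM hb mul0r.
  by rewrite DSh -[h * h * _]mulrA evD evD !evh evC !add0r.
have L0 : L%:K = 0.
  move: c00; rewrite -Lc0 !rmorphM /= => /eqP; rewrite !mulf_eq0 -pmulrn.
  by rewrite (negPf nz_t) (negPf nz_c) => /eqP.
have CE0 : (p %| CC - EE)%Z.
  by move: c00; rewrite intK_eq0 c0E rmorphM rmorphXn /= => /eqP; rewrite mulf_eq0 expf_eq0 (negPf nz_c) andbF.
rewrite dvdz_sqr //; set y := divz _ _.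
have badE b : double_root b -> bad p f b <-> y%:K = 0.
  move=> db; have [hb Sb] := key b db.
  have pL : (p %| L)%Z by rewrite intK_eq0 L0.
  have e : S * f = h * h * (A1 - a'%:P * A2) + P * h * (divz L p)%:P + P * (c ^+ n1 * y)%:P.
    rewrite DSh c0E !polyCM (polyC_divK pL) (polyC_divK CE0) -/y; ring.
  rewrite (bad_iff p_pr FtoK_alg e hb Sb) evC rmorphM rmorphXn /=.
  split=> [/eqP|->]; last by rewrite mulr0.
  by rewrite mulf_eq0 expf_eq0 (negPf nz_c) andbF => /eqP.
split=> [nb|/eqP nz b bb]; first by apply/eqP=> y0; apply: (nb b0); apply/badE.
by apply: nz; apply: (badE b (bad_double bb)).1.
Qed.

End Cases.

Lemma fpoly_monic_size (a c : int) (k m n : nat) : (n < k * m)%N ->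
  fpoly a c k m n \is monic /\ size (fpoly a c k m n) = (k * m).+1.
Proof.
move=> n_lt; have k_gt0 : (0 < k)%N by case: k n_lt.
have mon : 'X^k + c%:P \is monic by apply: monicXnaddC.
have sz : size (('X^k + c%:P) ^+ m) = (k * m).+1.
  have := size_exp ('X^k + c%:P) m; rewrite size_XnaddC // => <-.
  by rewrite prednK // size_poly_gt0 monic_neq0 ?monic_exp.
have lt_sz : (size (- (a%:P * 'X^n)) < size (('X^k + c%:P) ^+ m))%N.
  rewrite size_polyN sz mul_polyC (leq_ltn_trans (size_scale_leq _ _)) //.
  by rewrite size_polyXn.
split; last by rewrite /fpoly size_polyDl.
by rewrite monicE /fpoly lead_coefDl // -monicE monic_exp.
Qed.

(** Closes an implication of [cond] whose case hypothesis has been rewritten to a false Boolean. *)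
Ltac vacuous := let H := fresh in
  first [move=> H; discriminate H | move=> _ H; discriminate H
        | move=> _ _ H; discriminate H | move=> _ _ _ H; discriminate H].

(** * Matching the cases with the conjunction of implications *)

Section Condition.
Variables (p : nat) (K : closedFieldType) (FtoK : {rmorphism 'F_p -> K}).
Hypotheses (p_pr : prime p) (FtoK_alg : integralRange FtoK).
Variables (a c : int) (k m n : nat).
Hypotheses (n_lt : (n < k * m)%N) (n_gt0 : (0 < n)%N).
Hypothesis dbl : exists b : K, double_root a c k m n b.

Lemma no_bad_cond :
  (forall b : K, ~ bad p (fpoly a c k m n) b) <-> cond a c k m n p.
Proof.
have m_gt0 : (0 < m)%N by case: m n_lt; rewrite ?muln0.
have [pc|pc] := boolP (p%:Z %| c)%Z; have [pa|pa] := boolP (p%:Z %| a)%Z.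
- rewrite (case_i p_pr FtoK_alg n_lt n_gt0 pc pa) /cond pc pa.
  split=> [h|[h _]]; last exact: h.
  by split=> [_ _|]; [exact: h|do 5!(split; first by vacuous); vacuous].
- have [n1|n2] := leqP n 1.
    have {}n1 : n = 1%N by apply/eqP; rewrite eqn_leq n1.
    rewrite (case_ii p_pr FtoK_alg n_lt n_gt0 dbl pc pa n1) /cond pc (negPf pa).
    split=> [h|[_ [h _]]]; last exact: h.
    split; first by vacuous.
    split=> [_ _ _|]; first exact: h.
    split=> [_ _ n2|]; first by rewrite n1 in n2.
    by do 3!(split; first by vacuous); vacuous.
  rewrite (case_iii p_pr FtoK_alg n_lt n_gt0 pc pa n2) /cond pc (negPf pa).
  split=> [h|[_ [_ [h _]]]]; last exact: h.
  split; first by vacuous.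
  split=> [_ _ n1|]; first by rewrite n1 in n2.
  split=> [_ _ _|]; first exact: h.
  by do 3!(split; first by vacuous); vacuous.
- have [m1|m2] := leqP m 1.
    have {}m1 : m = 1%N by apply/eqP; rewrite eqn_leq m1.
    rewrite (case_iv_1 p_pr FtoK_alg n_lt n_gt0 dbl pc pa m1) /cond (negPf pc) pa.
    split=> [h|[_ [_ [_ [h _]]]]]; last exact: (h isT isT).2.
    do 3!(split; first by vacuous).
    split; last by do 2!(split; first by vacuous); vacuous.
    by move=> _ _; split=> [m2|_]; [rewrite m1 in m2|exact: h].
  rewrite (case_iv_ge2 p_pr FtoK_alg n_lt n_gt0 dbl pc pa m2) /cond (negPf pc) pa.
  split=> [h|[_ [_ [_ [h _]]]]]; last exact: (h isT isT).1.
  do 3!(split; first by vacuous).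
  split; last by do 2!(split; first by vacuous); vacuous.
  by move=> _ _; split=> [_|m1]; [exact: h|rewrite m1 in m2].
have [pk|pk] := boolP (p %| k)%N.
  rewrite (case_v p_pr FtoK_alg n_lt n_gt0 dbl pc pa pk) /cond (negPf pc) (negPf pa) pk.
  split=> [h|[_ [_ [_ [_ [h _]]]]]]; last exact: h.
  do 4!(split; first by vacuous).
  by split=> [_ _ _|]; [exact: h|split; vacuous].
have [pm|pm] := boolP (p %| m)%N.
  rewrite (case_vi p_pr FtoK_alg n_lt n_gt0 dbl pc pa pm).
  rewrite /cond (negPf pc) (negPf pa) (negPf pk) pm.
  split=> [h|[_ [_ [_ [_ [_ [h _]]]]]]]; last exact: h.
  do 5!(split; first by vacuous).
  by split=> [_ _ _ _|]; [exact: h|vacuous].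
rewrite (case_vii p_pr FtoK_alg n_lt n_gt0 dbl pc pa pk pm).
rewrite /cond (negPf pc) (negPf pa) (negPf pk) (negPf pm).
split=> [h|[_ [_ [_ [_ [_ [_ h]]]]]]]; last exact: h.
by do 6!(split; first by vacuous); move=> _ _ _ _; exact: h.
Qed.

End Condition.

Unset Implicit Arguments.

Theorem mainTheorem2 (a c : int) (k m n : nat) (theta : algC) :
  (n < k * m)%N -> (1 <= n)%N ->
  irreducible_poly (map_poly intr (fpoly a c k m n) : {poly rat}) ->
  root (map_poly intr (fpoly a c k m n)) theta ->
  (forall p : nat, prime p -> ((p%:Z) %| disc_monic (fpoly a c k m n))%Z ->
     (p_not_dvd_index theta p <-> cond a c k m n p)) /\
  ((forall x, ZK theta x <-> Ztheta theta x) <->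
   (forall p : nat, prime p -> ((p%:Z) %| disc_monic (fpoly a c k m n))%Z ->
      cond a c k m n p)).
Proof.
move=> n_lt n_gt0 irr_f f_theta.
have [mon_f sz_f] := fpoly_monic_size a c n_lt.
have size_f : (2 < size (fpoly a c k m n))%N by rewrite sz_f ltnS (leq_ltn_trans n_gt0).
(* The second half covers primes not dividing the discriminant: a bad point would be a double root,
   so these primes impose nothing in the global statement. *)
have torsion p : prime p ->
    (((p%:Z) %| disc_monic (fpoly a c k m n))%Z -> no_torsion theta p <-> cond a c k m n p) /\
    (~ ((p%:Z) %| disc_monic (fpoly a c k m n))%Z -> no_torsion theta p).
  move=> p_pr; have [K [FtoK FtoK_alg]] := countable_algebraic_closure 'F_p.
  have nobadP : no_torsion theta p <-> forall b : K, ~ bad p (fpoly a c k m n) b.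
    split=> [nt b bb|]; last exact: (torsion_free p_pr FtoK_alg mon_f irr_f f_theta).
    exact: (bad_torsion p_pr mon_f irr_f f_theta bb).
  rewrite nobadP (dvd_disc_root FtoK p_pr mon_f size_f); split=> [dbl|ndbl b bb].
    exact: (no_bad_cond p_pr FtoK_alg n_lt n_gt0 dbl).
  by apply: ndbl; exists b; apply: bad_root bb.
have index p := p_not_dvd_indexP mon_f size_f irr_f f_theta (p := p).
split=> [p p_pr p_disc|]; first by rewrite index //; apply: (torsion p p_pr).1.
rewrite -(ZK_eq_Ztheta mon_f size_f irr_f f_theta).
split=> [nt p p_pr p_disc|conds p p_pr]; first by apply/(torsion p p_pr).1/nt.
have [p_disc|/negP p_disc] := boolP ((p%:Z) %| disc_monic (fpoly a c k m n))%Z.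
  exact: ((torsion p p_pr).1 p_disc).2 (conds p p_pr p_disc).
exact: (torsion p p_pr).2 p_disc.
Qed.
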